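(* Let $0<\epsilon<\frac14$. There exist constants $C,c>0$, depending only on $\epsilon$, such that the following holds. Let $E$ be an $\epsilon$-excited random walk on $\mathbb{Z}^2$ starting from $(\emptyset,(0,0))$. Then for every integer $n\ge 1$, $$\mathbb{P}\big(E(n)_1>cn\big)>1-Ce^{-c\log^2 n},$$ where $E(n)_1$ denotes the first coordinate of $E(n)$.
   Context: Excited random walk: let $0<\epsilon<\frac14$, let $\mathcal{V}\subset\mathbb{Z}^2$ (the set of vertices declared already visited) and let $w\in\mathbb{Z}^2$. The $\epsilon$-excited random walk starting from $(\mathcal{V},w)$ is the stochastic process $(E(n))_{n\ge0}$ on $\mathbb{Z}^2$ with $E(0)=w$ and the following transition rule, conditionally on $E(0),\dots,E(n)$. If $E(n)\notin\mathcal{V}$ and $E(n)\neq E(k)$ for all $0\le k<n$ (a vertex visited for the first time), then $E(n+1)$ equals $E(n)+(1,0)$ with probability $\frac14+\epsilon$, $E(n)+(-1,0)$ with probability $\frac14-\epsilon$, and each of $E(n)+(0,1)$, $E(n)+(0,-1)$ with probability $\frac14$. Otherwise, $E(n+1)$ is uniformly distributed over the four nearest neighbours of $E(n)$. Conventions: $\log x$ stands for $\max\{\log x,1\}$ (natural logarithm inside the maximum), and $\log^a x=(\log x)^a$. *)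

(* Defs.v *)
From HB Require Import structures.
From mathcomp Require Import all_boot all_order all_algebra.
From mathcomp Require Import all_classical all_reals all_analysis.

Set Implicit Arguments.
Unset Strict Implicit.
Unset Printing Implicit Defensive.

Import Order.TTheory GRing.Theory Num.Theory.

Local Open Scope classical_set_scope.
Local Open Scope ring_scope.

Definition srw_step (R : realType) (v : int * int) : R :=
  if v \in [:: (1, 0); (-1, 0); (0, 1); (0, -1)] then 4^-1 else 0.

Definition excited_step (R : realType) (eps : R) (v : int * int) : R :=
  if v == (1, 0) then 4^-1 + eps
  else if v == (-1, 0) then 4^-1 - eps
  else if (v == (0, 1)) || (v == (0, -1)) then 4^-1
  else 0.

(* Only x 0, ..., x n matter. *)
Definition first_visit (V : set (int * int)) (x : nat -> int * int) (n : nat)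
    : Prop :=
  ~ V (x n) /\ forall k, (k < n)%N -> x n <> x k.

Definition erw_transition (R : realType) (eps : R) (V : set (int * int))
    (x : nat -> int * int) (n : nat) (y : int * int) : R :=
  if `[< first_visit V x n >] then excited_step eps (y - x n)
  else srw_step R (y - x n).

(* Meaningful only when 0 < P A. *)
Definition cond_prob d (T : measurableType d) (R : realType)
    (P : probability T R) (B A : set T) : R :=
  fine (P (B `&` A)) / fine (P A).

Definition history d (T : measurableType d) (E : nat -> T -> int * int)
    (x : nat -> int * int) (n : nat) : set T :=
  [set t | forall k, (k <= n)%N -> E k t = x k].

(* Z^2 carries the discrete sigma-algebra, and as it is countable,
   conditioning on E 0, ..., E n is conditioning on the histories of positive
   probability. *)
Definition excited_random_walk d (T : measurableType d) (R : realType)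
    (P : probability T R) (eps : R) (V : set (int * int)) (w : int * int)
    (E : nat -> T -> int * int) : Prop :=
  [/\ forall n (A : set (int * int)), measurable (E n @^-1` A),
      P [set t | E 0%N t = w] = 1%E
    & forall (n : nat) (x : nat -> int * int) (y : int * int),
        (0 < P (history E x n))%E ->
        cond_prob P [set t | E n.+1 t = y] (history E x n)
        = erw_transition eps V x n y].

(* log with the convention that it is never below 1. *)
Definition log1 (R : realType) (x : R) : R := Num.max (ln x) 1.

(* Main.v *)
Require Import Defs.
From HB Require Import structures.
From mathcomp Require Import all_boot all_order all_algebra.
From mathcomp Require Import all_classical all_reals all_analysis.
From mathcomp Require Import ring lra zify.

Set Implicit Arguments.
Unset Strict Implicit.
Unset Printing Implicit Defensive.

Import Order.TTheory GRing.Theory Num.Theory.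

Local Open Scope classical_set_scope.
Local Open Scope ring_scope.

(* Write X for the first coordinate and R_n for the number of sites visited
   before time n. Then X_n - 2 eps R_n is a martingale with bounded increments,
   so everything rests on lower bounds for R_n.

   Range. The function h(w) = ln (1 + |w|^2) is subharmonic for the simple random
   walk, strictly so at 0, and its gradient is O(1 / |w|). For a walk which gets
   a drift at new sites only, the sum over i <= j of h(E_j - E_i) therefore
   grows at least like the number of pairs i < j with E_i = E_j, minus the sum
   over new sites z and past positions w of 1 / |z - w|; since new sites are
   distinct, r of them contribute O(sqrt r) for each w. As h is only
   logarithmic, few sites cannot be visited too often: with probability >= 1/2
   a block of l steps, whatever its past, visits at least l^(8/13) sites. Trying m
   blocks in a row gives R_n >> sqrt n, hence X_n >> sqrt n, up to probability
   exp(- c m), where n is a fixed power of m.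

   Renewal. Consequently a walk standing at a strict record of X has a positive
   probability never to go back, and if it does go back it does so quickly. So
   a time which cuts the trajectory into an earlier part strictly to the left of
   the later part occurs soon, and the gaps between consecutive such times are
   independent, with very light tails: there are linearly many of them, and X
   increases by at least 1 between two of them. *)

(** * Walks with a drift policy, as weighted trees of histories *)

Notation pos := (int * int)%type.

Definition dirs : seq pos := [:: (1, 0); (-1, 0); (0, 1); (0, -1)].

Section Walk.
Variable R : realType.
Implicit Types (d : seq pos -> R) (n : nat) (s t u v : seq pos) (f g : seq pos -> R).

Definition move s (e : pos) : seq pos := (head 0 s + e) :: s.

Definition avg (a : R) (F : pos -> R) : R :=
  (4^-1 + a) * F (1, 0) + (4^-1 - a) * F (-1, 0) + 4^-1 * F (0, 1) + 4^-1 * F (0, -1).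

(* A history is the list of visited sites, most recent first; [d] is the drift
   policy, and [Ex d n s f] is the expectation of [f] after [n] further steps. *)
Fixpoint Ex d n s f : R :=
  if n is n'.+1 then avg (d s) (fun e => Ex d n' (move s e) f) else f s.

Fixpoint reach n s v : Prop :=
  if n is n'.+1 then exists2 e, e \in dirs & reach n' (move s e) v else v = s.

Definition policy (eps : R) d := forall s, 0 <= d s <= eps.

Lemma avg_le (eps a : R) F G : eps < 4^-1 -> 0 <= a <= eps ->
  (forall e, e \in dirs -> F e <= G e) -> avg a F <= avg a G.
Proof.
move=> e4 /andP[a0 ae] H; rewrite /avg.
have h1 := H (1, 0) isT; have h2 := H (-1, 0) isT.
have h3 := H (0, 1) isT; have h4 := H (0, -1) isT.
have e2 : 0 <= 4^-1 - a by lra.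
have e3 : 0 <= 4^-1 + a by lra.
have e5 : (0:R) <= 4^-1 by lra.
by rewrite !lerD // ler_wpM2l.
Qed.

Lemma avg_eq (a : R) F G :
  (forall e, e \in dirs -> F e = G e) -> avg a F = avg a G.
Proof. by move=> H; rewrite /avg !H. Qed.

Lemma avg_cst (a c : R) : avg a (fun=> c) = c.
Proof. rewrite /avg; lra. Qed.

Lemma avgD (a : R) F G : avg a (fun e => F e + G e) = avg a F + avg a G.
Proof. by rewrite /avg; ring. Qed.

Lemma avgZ (a c : R) F : avg a (fun e => c * F e) = c * avg a F.
Proof. by rewrite /avg; ring. Qed.

Section Policy.
Variables (eps : R) (d : seq pos -> R).
Hypotheses (eps4 : eps < 4^-1) (dP : policy eps d).

Lemma Ex_le n s f g : (forall v, reach n s v -> f v <= g v) ->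
  Ex d n s f <= Ex d n s g.
Proof.
elim: n s => [|n IHn] s H /=; first exact: H.
by apply: (avg_le eps4 (dP s)) => e he; apply: IHn => v hv; apply: H; exists e.
Qed.

Lemma Ex_eq n s f g : (forall v, reach n s v -> f v = g v) ->
  Ex d n s f = Ex d n s g.
Proof.
elim: n s => [|n IHn] s H /=; first exact: H.
by apply: avg_eq => e he; apply: IHn => v hv; apply: H; exists e.
Qed.

Lemma Ex_cst n s c : Ex d n s (fun=> c) = c.
Proof.
elim: n s => [//|n IHn] s /=.
by rewrite -[RHS](avg_cst (d s)); apply: avg_eq.
Qed.

Lemma ExD n s f g : Ex d n s (fun v => f v + g v) = Ex d n s f + Ex d n s g.
Proof.
elim: n s => [//|n IHn] s /=.
by rewrite -avgD; apply: avg_eq.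
Qed.

Lemma ExZ n s c f : Ex d n s (fun v => c * f v) = c * Ex d n s f.
Proof.
elim: n s => [//|n IHn] s /=.
by rewrite -avgZ; apply: avg_eq.
Qed.

Lemma ExB n s f g : Ex d n s (fun v => f v - g v) = Ex d n s f - Ex d n s g.
Proof.
rewrite -[X in _ - X]mul1r -mulNr -ExZ -ExD.
by apply: Ex_eq => v _; rewrite mulN1r.
Qed.

Lemma Ex_sum n s (I : Type) (r : seq I) (P : pred I) (F : I -> seq pos -> R) :
  Ex d n s (fun v => \sum_(i <- r | P i) F i v) = \sum_(i <- r | P i) Ex d n s (F i).
Proof.
elim: r => [|i r IHr].
  rewrite big_nil -[RHS](Ex_cst n s); apply: Ex_eq => v _; exact: big_nil.
rewrite big_cons -IHr; case: ifP => Pi.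
  by rewrite -ExD; apply: Ex_eq => v _; rewrite big_cons Pi.
by apply: Ex_eq => v _; rewrite big_cons Pi.
Qed.

Lemma Ex_ge0 n s f : (forall v, reach n s v -> 0 <= f v) -> 0 <= Ex d n s f.
Proof. by move=> H; rewrite -(Ex_cst n s 0); exact: Ex_le. Qed.

Lemma Ex_ub n s f c : (forall v, reach n s v -> f v <= c) -> Ex d n s f <= c.
Proof. by move=> H; rewrite -[leRHS](Ex_cst n s c); exact: Ex_le. Qed.

Lemma Ex_comp m n s f : Ex d (m + n) s f = Ex d m s (fun v => Ex d n v f).
Proof. by elim: m s => [//|m IHm] s /=; apply: avg_eq. Qed.

Lemma Ex1_le1 n s (b : pred (seq pos)) : Ex d n s (fun v => (b v)%:R) <= 1.
Proof. by apply: Ex_ub => v _; rewrite lern1; case: (b v). Qed.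

Lemma Ex1_ge0 n s (b : pred (seq pos)) : 0 <= Ex d n s (fun v => (b v)%:R).
Proof. by apply: Ex_ge0 => v _; exact: ler0n. Qed.

End Policy.

Lemma reach_size n s v : reach n s v -> size v = (n + size s)%N.
Proof. by elim: n s => [s /= ->//|n IHn] s /= [e _ /IHn ->] /=; rewrite addnS. Qed.

Lemma reach_cat n s v : reach n s v -> exists2 a, size a = n & v = a ++ s.
Proof.
elim: n s => [s ->|n IHn s /= [e _ /IHn[a sa ->]]]; first by exists [::].
by exists (rcons a (head 0 s + e)); rewrite ?size_rcons ?sa// cat_rcons.
Qed.

Lemma reach_x n s v : reach n s v ->
  (head 0 s).1 - n%:Z <= (head 0 v).1 <= (head 0 s).1 + n%:Z.
Proof.
elim: n s => [s ->|n IHn s /= [e he /IHn]]; first by lia.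
rewrite /move /= => /andP[h1 h2].
have : -1 <= e.1 <= 1 by move: he; rewrite !inE => /or4P[] /eqP->.
rewrite /= in h1 h2 *; lia.
Qed.

Lemma reach_split m n s v : reach (m + n) s v ->
  exists2 v', reach m s v' & reach n v' v.
Proof.
elim: m s => [|m IHm] s /=; first by move=> h; exists s.
move=> [e he /IHm[v' h1 h2]]; exists v' => //; exists e => //.
Qed.

Lemma Ex_cat d n u t f : u != [::] ->
  Ex d n (u ++ t) f = Ex (fun v => d (v ++ t)) n u (fun v => f (v ++ t)).
Proof.
elim: n u => [//|n IHn] u u0 /=; apply: avg_eq => e he.
have -> : move (u ++ t) e = move u e ++ t by rewrite /move; case: u u0.
exact: IHn.
Qed.

Lemma Ex_map d n u (z : pos) f : u != [::] ->
  Ex d n [seq w + z | w <- u] f =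
  Ex (fun v => d [seq w + z | w <- v]) n u (fun v => f [seq w + z | w <- v]).
Proof.
elim: n u => [//|n IHn] u u0 /=; apply: avg_eq => e he.
have -> : move [seq w + z | w <- u] e = [seq w + z | w <- move u e].
  by rewrite /move; case: u u0 => //= a u _; rewrite addrAC.
exact: IHn.
Qed.

Lemma Ex_vanish d n s f : (forall a, f (a ++ s) = 0) -> Ex d n s f = 0.
Proof.
move=> H; rewrite -(Ex_cst d n s 0); apply: Ex_eq => v /reach_cat[a _ ->].
exact: H.
Qed.

(** Once [A] fails it fails for every later history, and there [f] vanishes; so the two policies are
    compared only as long as [A] holds. *)
Lemma Ex_killed (A : pred (seq pos)) d d' n u f :
  u != [::] ->
  (forall a v, A (a ++ v) -> A v) ->
  (forall v, v != [::] -> A v -> d v = d' v) ->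
  (forall v, ~~ A v -> f v = 0) ->
  Ex d n u f = Ex d' n u f.
Proof.
move=> u0 AS Hd Hf; elim: n u u0 => [//|n IHn] u u0.
case Au: (A u).
  by rewrite /= Hd //; apply: avg_eq => e _; exact: IHn.
by rewrite !Ex_vanish // => a; apply: Hf; apply/negP => /AS; rewrite Au.
Qed.

Definition fresh s := head 0 s \notin behead s.

Definition erw (eps : R) s : R := if fresh s then eps else 0.

Lemma erw_policy eps : 0 <= eps -> policy eps (erw eps).
Proof. by move=> e0 s; rewrite /erw; case: ifP; rewrite ?e0 lexx ?e0. Qed.

Definition x_ge (L : int) : pred (seq pos) := all (fun p : pos => L <= p.1).
Definition x_lt (L : int) : pred (seq pos) := all (fun p : pos => p.1 < L).

(** A site at or right of [L] does not occur in [t], so [u] alone decides whether it is fresh. *)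
Lemma erw_halfspace eps L u t : u != [::] -> x_ge L u -> x_lt L t ->
  erw eps (u ++ t) = erw eps u.
Proof.
case: u => [//|z u] _ /= /andP[zL _] tL; rewrite /erw /fresh /= mem_cat.
suff /negbTE -> : z \notin t by rewrite orbF.
by apply/negP => /(allP tL) /=; rewrite ltNge zL.
Qed.

Lemma erw_map eps u (z : pos) : u != [::] ->
  erw eps [seq w + z | w <- u] = erw eps u.
Proof.
case: u => [//|w u] _; rewrite /erw /fresh /=.
by have /= -> := mem_map (@addIr _ z) u w.
Qed.

(* Until it backtracks, a walk that stands at a strict record of its first
   coordinate behaves like a walk started from the origin. *)
Lemma Ex_record eps n (z : pos) t f : x_lt z.1 t ->
  (forall v, ~~ x_ge z.1 v -> f (v ++ t) = 0) ->
  Ex (erw eps) n (z :: t) f =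
  Ex (erw eps) n [:: 0] (fun v => f ([seq w + z | w <- v] ++ t)).
Proof.
move=> tz Hf; rewrite -cat1s Ex_cat //.
rewrite (@Ex_killed (x_ge z.1) _ (erw eps)) //.
- have -> : [:: z] = [seq w + z | w <- [:: 0]] by rewrite /= add0r.
  rewrite Ex_map //.
  apply: (@Ex_killed predT) => // v v0 _.
  by rewrite erw_map.
- by move=> a v; rewrite /x_ge all_cat => /andP[].
- by move=> v v0 vz; rewrite (@erw_halfspace _ z.1).
Qed.

End Walk.

(** * The logarithmic potential *)

Section Potential.
Variable R : realType.

Definition pot (p : pos) : R := ln (1 + p.1%:~R ^+ 2 + p.2%:~R ^+ 2).

Definition nrm (p : pos) : nat := maxn `|p.1|%N `|p.2|%N.

Definition kap (p : pos) : R := 16 / (nrm p).+1%:R.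

Lemma kap_ge0 p : 0 <= kap p.
Proof. by rewrite divr_ge0. Qed.

Lemma pot_ge0 p : 0 <= pot p.
Proof.
rewrite ln_ge0 //.
have := sqr_ge0 (p.1%:~R : R); have := sqr_ge0 (p.2%:~R : R); lra.
Qed.

Lemma pot0 : pot 0 = 0.
Proof. by rewrite /pot /= !mulr0z expr0n /= !addr0 ln1. Qed.

Lemma pot_lap p :
  4 * pot p + (p == 0)%:R * (4 * ln 2) <=
  pot (p + (1, 0)) + pot (p + (-1, 0)) + pot (p + (0, 1)) + pot (p + (0, -1)).
Proof.
have [->|p0] := eqVneq p 0.
  rewrite pot0 /pot /= !add0r !mulr0z !mulr1z expr0n /= ?mulrN1z ?sqrrN ?expr1n ?addr0.
  rewrite ?[(-1)%:~R]rmorphN1 ?sqrrN ?expr1n.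
  by have -> : 1 + 1 = 2 :> R by []; lra.
rewrite mul0r addr0 /pot /=.
set x : R := p.1%:~R; set y : R := p.2%:~R.
rewrite !addr0 !rmorphD /= !rmorphN /= !rmorph1 -/x -/y.
set A := 1 + x ^+ 2 + y ^+ 2.
have x2 := sqr_ge0 x; have y2 := sqr_ge0 y.
have A0 : 0 < A by rewrite /A; lra.
have sx (z : R) : 0 <= z ^+ 2 := sqr_ge0 z.
have p1 : 0 < 1 + (x + 1) ^+ 2 + y ^+ 2 by have := sx (x + 1); lra.
have p2 : 0 < 1 + (x - 1) ^+ 2 + y ^+ 2 by have := sx (x - 1); lra.
have p3 : 0 < 1 + x ^+ 2 + (y + 1) ^+ 2 by have := sx (y + 1); lra.
have p4 : 0 < 1 + x ^+ 2 + (y - 1) ^+ 2 by have := sx (y - 1); lra.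
rewrite -!lnM ?posrE ?mulr_gt0 //.
have -> : 4 * ln A = ln (A ^+ 4) by rewrite lnXn // mulr_natl.
rewrite ler_ln ?posrE ?mulr_gt0 ?exprn_gt0 //.
rewrite -subr_ge0 /A.
have -> : (1 + (x + 1) ^+ 2 + y ^+ 2) * (1 + (x - 1) ^+ 2 + y ^+ 2) *
  (1 + x ^+ 2 + (y + 1) ^+ 2) * (1 + x ^+ 2 + (y - 1) ^+ 2) -
  (1 + x ^+ 2 + y ^+ 2) ^+ 4 = 2 * (1 + x ^+ 2 + y ^+ 2) ^+ 2 +
  8 * (1 + x ^+ 2 + y ^+ 2) + 5 + 16 * (x ^+ 2 * y ^+ 2) by ring.
have h5 : 0 <= x ^+ 2 * y ^+ 2 by rewrite mulr_ge0.
have h6 := sx (1 + x ^+ 2 + y ^+ 2); lra.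
Qed.

Lemma ln_sub_le (a b : R) : 0 < a -> 0 < b -> ln b - ln a <= (b - a) / a.
Proof.
move=> a0 b0; rewrite -ln_div ?posrE //.
have h : (b - a) / a = b / a - 1 by field; lra.
have -> : b / a = 1 + (b - a) / a by rewrite h; lra.
by apply: le_ln1Dx; have := divr_gt0 b0 a0; lra.
Qed.

(** Concavity of [ln] bounds the difference by -4 x / (1 + (x + 1)^2 + y^2). A rightward drift
    lowers the mean of [pot] by this difference times the drift. *)
Lemma pot_grad p : pot (p + (-1, 0)) - pot (p + (1, 0)) <= kap p.
Proof.
rewrite /pot /= !addr0 !rmorphD /= !rmorphN /= !rmorph1.
have x2 (z : R) : 0 <= z ^+ 2 := sqr_ge0 z.
set x : R := p.1%:~R; set y : R := p.2%:~R.
have a0 : 0 < 1 + (x + 1) ^+ 2 + y ^+ 2 by have := x2 (x + 1); have := x2 y; lra.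
have b0 : 0 < 1 + (x - 1) ^+ 2 + y ^+ 2 by have := x2 (x - 1); have := x2 y; lra.
apply: le_trans (ln_sub_le a0 b0) _; rewrite /kap.
have M1 : (0 : R) < (nrm p).+1%:R by [].
rewrite ler_pdivrMr // mulrAC ler_pdivlMr //.
have -> : 1 + (x - 1) ^+ 2 + y ^+ 2 - (1 + (x + 1) ^+ 2 + y ^+ 2) = - 4 * x by ring.
have [xge0|xlt0] := lerP 0 x.
  apply: (@le_trans _ _ 0); last by rewrite mulr_ge0 ?ltW.
  rewrite mulr_le0_ge0 //; lra.
have Ex' : ((`|p.1|%N)%:R : R) = - x.
  by rewrite natr_absz ler0_norm ?rmorphN // -(ler_int R); exact: ltW.
have Ey : ((`|p.2|%N)%:R : R) ^+ 2 = y ^+ 2.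
  by rewrite natr_absz intr_norm real_normK ?num_real.
set X := - x in Ex'.
have X0 : 0 < X by rewrite /X; lra.
have -> : x = - X by rewrite /X; lra.
rewrite -[(nrm p).+1%:R]natr1 /nrm; have [le|lt] := leqP `|p.1|%N `|p.2|%N.
  have leR : X <= (`|p.2|%N)%:R by rewrite -Ex' ler_nat.
  rewrite -Ey; set Y := (`|p.2|%N)%:R in leR *; nra.
rewrite Ex'; have := x2 y; have := x2 (2 * X - 3); nra.
Qed.

Lemma avg_pot (eps a : R) (q : pos) (b : bool) : eps < 4^-1 -> 0 <= a <= eps * b%:R ->
  pot q + (q == 0)%:R * ln 2 - eps * (b%:R * kap q) <= avg a (fun e => pot (q + e)).
Proof.
move=> e4 /andP[a0 ae]; rewrite /avg.
have h1 := pot_lap q; have h2 := pot_grad q; have h3 := kap_ge0 q.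
have : a * (pot (q + (-1, 0)) - pot (q + (1, 0))) <= eps * (b%:R * kap q).
  rewrite mulrA; apply: le_trans (ler_wpM2l a0 h2) _.
  exact: ler_wpM2r.
lra.
Qed.

Lemma count_box (s : seq pos) j : uniq s ->
  (count (fun p => nrm p <= j)%N s <= (j.*2.+1) ^ 2)%N.
Proof.
move=> us; rewrite -size_filter.
pose I := [seq (i%:Z - j%:Z) | i <- iota 0 j.*2.+1].
have -> : (j.*2.+1 ^ 2)%N = size [seq (x, y) | x <- I, y <- I].
  by rewrite size_allpairs !size_map size_iota mulnn.
apply: uniq_leq_size; first exact: filter_uniq.
have HI (z : int) : (absz z <= j)%N -> z \in I.
  move=> zj; apply/mapP; exists (absz (z + j%:Z)); first by rewrite mem_iota; lia.
  lia.
move=> [x y]; rewrite mem_filter /nrm geq_max => /andP[/andP[hx hy] _].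
apply/allpairsPdep; exists x, y; split => //; exact: HI.
Qed.

(** A layer-cake formula, from 1 / ((j + 1) (j + 2)) = 1 / (j + 1) - 1 / (j + 2); it turns sums of
    inverse distances into counts of points in boxes. *)
Lemma inv_telescope (a rho : nat) : (a.+1%:R^-1 : R) <=
  \sum_(0 <= j < rho) (a <= j)%N%:R / (j.+1%:R * j.+2%:R) + rho.+1%:R^-1.
Proof.
have sum_ge0 k : (0 : R) <= \sum_(0 <= j < k) (a <= j)%N%:R / (j.+1%:R * j.+2%:R).
  by rewrite sumr_ge0 // => j _; rewrite divr_ge0 // mulr_ge0.
elim: rho => [|rho IH].
  by rewrite big_geq // add0r lef_pV2 ?posrE // ler_nat.
rewrite big_nat_recr //=; case: (leqP a rho) => h.
  have -> : (1 : R) / (rho.+1%:R * rho.+2%:R) = rho.+1%:R^-1 - rho.+2%:R^-1.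
    by rewrite -[rho.+2%:R]natr1 -[rho.+1%:R]natr1; field; have := ler0n R rho; lra.
  by rewrite -addrA subrK.
rewrite mul0r addr0; apply: ler_wpDl => //.
by rewrite lef_pV2 ?posrE // ler_nat; lia.
Qed.

(* A bound of order [sqrt K] for [K] distinct sites: the worst case is a ball. *)
Lemma sum_kap (s : seq pos) (rho : nat) : uniq s -> (size s <= rho ^ 2)%N ->
  \sum_(p <- s) kap p <= 80 * rho%:R.
Proof.
move=> us sz.
have step : \sum_(p <- s) ((nrm p).+1%:R^-1 : R) <= 5 * rho%:R.
  apply: (@le_trans _ _ (\sum_(p <- s) (\sum_(0 <= j < rho)
     (nrm p <= j)%N%:R / (j.+1%:R * j.+2%:R) + rho.+1%:R^-1))).
    by apply: ler_sum => p _; exact: inv_telescope.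
  rewrite big_split /= exchange_big /=.
  have h1 : \sum_(p <- s) (rho.+1%:R^-1 : R) <= rho%:R.
    rewrite big_const_seq count_predT iter_addr_0 -[leLHS]mulr_natr mulrC.
    rewrite ler_pdivrMr // -natrM ler_nat (leq_trans sz) //.
    by rewrite -mulnn leq_mul2l leqnSn orbT.
  (* Each layer contributes at most 4, because (2 j + 1)^2 <= 4 (j + 1) (j + 2). *)
  have h2 : \sum_(0 <= j < rho) \sum_(p <- s)
      ((nrm p <= j)%N%:R / (j.+1%:R * j.+2%:R) : R) <= 4 * rho%:R.
    apply: (@le_trans _ _ (\sum_(0 <= j < rho) 4)); last first.
      by rewrite big_const_nat subn0 iter_addr_0 mulr_natr.
    apply: ler_sum => j _; rewrite -mulr_suml ler_pdivrMr ?mulr_gt0 //.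
    rewrite -natr_sum -big_mkcond /= sum1_count.
    rewrite -!natrM ler_nat (leq_trans (count_box j us)) //.
    by rewrite -mul2n; nia.
  lra.
rewrite -mulr_sumr.
have -> : 80 * rho%:R = 16 * (5 * rho%:R) :> R by ring.
by rewrite ler_wpM2l.
Qed.

End Potential.

(** * The range of a block *)

Definition dist (u : seq pos) : nat := size (undup u).

Lemma dist_cat a u : (dist u <= dist (a ++ u))%N.
Proof. by rewrite /dist undup_cat size_cat leq_addl. Qed.

Lemma dist_catl a u : (dist a <= dist (a ++ u))%N.
Proof.
rewrite /dist; apply: uniq_leq_size; first exact: undup_uniq.
by move=> p; rewrite !mem_undup mem_cat => ->.
Qed.

Definition alive (r : nat) (u : seq pos) : bool := (dist u < r)%N.

Lemma alive_cat r a u : alive r (a ++ u) -> alive r u.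
Proof. exact/leq_ltn_trans/dist_cat. Qed.

Lemma fresh_dist (u : seq pos) : u != [::] -> dist u = (fresh u + dist (behead u))%N.
Proof. by case: u => // z u _; rewrite /dist /fresh /=; case: (z \in u). Qed.

(** Pairs of times spent at the same site, each time being also paired with itself. The latest
    position is left out, as no step has been made from it yet. *)
Fixpoint pairs r (u : seq pos) : nat :=
  if u is _ :: u' then (pairs r u' + alive r u' * count_mem (head 0%R u') u')%N else 0%N.

(** The sites where a drift may have acted before the stopping rule; again the latest position does
    not count. *)
Fixpoint newsites r (u : seq pos) : seq pos :=
  if u is _ :: u' then
    if [&& u' != [::], alive r u' & fresh u'] then head 0 u' :: newsites r u'
    else newsites r u'
  else [::].

Lemma newsites_cons r z u : newsites r (z :: u) =
  if [&& u != [::], alive r u & fresh u] then head 0 u :: newsites r u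
  else newsites r u.
Proof. by []. Qed.

Lemma newsites_sub r z u : {subset newsites r (z :: u) <= u}.
Proof.
elim: u z => [//|y u IH] z p; rewrite newsites_cons.
case: ifP => [_|_ /IH h]; last by rewrite inE h orbT.
by rewrite inE => /orP[/eqP->|/IH h]; rewrite inE ?eqxx // h orbT.
Qed.

Lemma newsites_uniq r u : uniq (newsites r u).
Proof.
case: u => [//|z u]; elim: u z => [//|y u IH] z.
rewrite newsites_cons; case: ifP => [/and3P[_ _ fu]|_]; last exact: IH.
rewrite cons_uniq IH andbT; apply/negP => /newsites_sub h.
by move: fu; rewrite /fresh h.
Qed.

Lemma newsites_size r u : (size (newsites r u) <= r)%N.
Proof.
elim: u => [//|z u IH].
have [au|nau] := boolP (alive r u).
  apply: leq_trans (ltnW au); rewrite /dist.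
  apply: uniq_leq_size; first exact: newsites_uniq.
  by move=> p /newsites_sub; rewrite mem_undup.
by rewrite newsites_cons (negbTE nau) andbF.
Qed.

Section Range.
Variable R : realType.
Variables (eps : R) (d : seq pos -> R).
Hypotheses (eps0 : 0 < eps) (eps4 : eps < 4^-1)
  (dP : forall u, 0 <= d u <= eps * (fresh u)%:R).

Let dpol : policy eps d.
Proof.
move=> u; have /andP[-> h] := dP u; rewrite (le_trans h) //.
by case: (fresh u); rewrite /= ?mulr1 ?mulr0 // ltW.
Qed.

Definition Psi (u : seq pos) : R := \sum_(w <- u) pot R (head 0 u - w).

Lemma Psi_ge0 u : 0 <= Psi u.
Proof. by apply: sumr_ge0 => w _; exact: pot_ge0. Qed.

Definition kapsum (u : seq pos) : R := \sum_(w <- u) kap R (head 0 u - w).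

Fixpoint drifts r (u : seq pos) : R :=
  if u is _ :: u' then drifts r u' + (alive r u')%:R * ((fresh u')%:R * kapsum u')
  else 0.

Definition compensator r u : R := ln 2 * (pairs r u)%:R - eps * drifts r u.

Lemma avg_sum (a : R) (u : seq pos) (F : pos -> pos -> R) :
  avg a (fun e => \sum_(w <- u) F w e) = \sum_(w <- u) avg a (F w).
Proof.
elim: u => [|w u IH].
  by rewrite big_nil -[RHS](avg_cst a); apply: avg_eq => e _; rewrite big_nil.
by rewrite big_cons -IH -avgD; apply: avg_eq => e _; rewrite big_cons.
Qed.

(** Apply [avg_pot] to each past position: every visit to the current site gains [ln 2], the drift
    costs [kap], and the new position adds only [pot 0 = 0]. *)
Lemma Psi_step u : u != [::] ->
  Psi u + (ln 2 * (count_mem (head 0 u) u)%:R - eps * ((fresh u)%:R * kapsum u))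
  <= avg (d u) (fun e => Psi (move u e)).
Proof.
move=> u0.
have -> : avg (d u) (fun e => Psi (move u e)) =
    \sum_(w <- u) avg (d u) (fun e => pot R ((head 0 u - w) + e)).
  rewrite -avg_sum; apply: avg_eq => e _.
  rewrite /Psi /move big_cons /= subrr pot0 add0r.
  by apply: eq_bigr => w _; rewrite addrAC.
have -> : Psi u + (ln 2 * (count_mem (head 0 u) u)%:R - eps * ((fresh u)%:R * kapsum u))
   = \sum_(w <- u) (pot R (head 0 u - w) + (head 0 u - w == 0)%:R * ln 2
       - eps * ((fresh u)%:R * kap R (head 0 u - w))).
  rewrite big_split big_split /= -/(Psi u) sumrN -2!mulr_sumr -/(kapsum u) -addrA.
  congr (_ + (_ + _)); rewrite -mulr_suml mulrC; congr (_ * _).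
  rewrite -sum1_count natr_sum big_mkcond /=; apply: eq_bigr => w _.
  by rewrite subr_eq0 eq_sym; case: eqP.
by apply: ler_sum => w _; exact: avg_pot.
Qed.

Lemma compensator_frozen r n u : ~~ alive r u ->
  Ex d n u (compensator r) = compensator r u.
Proof.
move=> nu; rewrite -[RHS](Ex_cst d n u); apply: Ex_eq => v /reach_cat[a _ ->{v}].
elim: a => [//|z a <-]; rewrite /compensator /=.
have -> : alive r (a ++ u) = false by apply: contraNF nu; exact: alive_cat.
by rewrite !mul0r mul0n !addr0 addn0.
Qed.

(* The compensated potential [Psi] is a submartingale; it is stopped as soon as
   [r] distinct sites have been visited. *)
Lemma compensator_le r n u B : u != [::] -> alive r u ->
  (forall j v, (j <= n)%N -> reach j u v -> Psi v <= B) ->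
  Ex d n u (compensator r) <= compensator r u + B - Psi u.
Proof.
elim: n u => [|n IH] u u0 au HB.
  by have := HB 0%N u isT erefl; rewrite /=; lra.
have step := Psi_step u0.
rewrite /=.
apply: (@le_trans _ _ (avg (d u) (fun e => (compensator r (move u e) + B) + (-1) * Psi (move u e)))).
  apply: (avg_le eps4 (dpol u)) => e he.
  have HB' j v : (j <= n)%N -> reach j (move u e) v -> Psi v <= B.
    by move=> jn rv; apply: (HB j.+1) => //; exists e.
  have [am|nam] := boolP (alive r (move u e)).
    by have := IH (move u e) isT am HB'; lra.
  rewrite compensator_frozen //.
  by have := HB' 0%N (move u e) isT erefl; lra.
rewrite avgD avgZ.
have -> : avg (d u) (fun e => compensator r (move u e) + B) =
  compensator r u + (ln 2 * (count_mem (head 0 u) u)%:R - eps * ((fresh u)%:R * kapsum u)) + B.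
  rewrite -[RHS](avg_cst (d u)); apply: avg_eq => e _.
  rewrite /compensator /= au mul1r mul1n natrD; ring.
lra.
Qed.

(** Let each new site interact with all positions of [u] and exchange the sums: seen from a fixed
    position, the new sites are at most [r] distinct points, so [sum_kap] applies. *)
Lemma drifts_le r u (rho : nat) : (r <= rho ^ 2)%N ->
  drifts r u <= (size u)%:R * (80 * rho%:R).
Proof.
move=> rrho.
apply: (@le_trans _ _ (\sum_(z <- newsites r u) \sum_(w <- u) kap R (z - w))).
  elim: u => [|z u IH]; first by rewrite /= big_nil.
  rewrite /=.
  have mono (s : seq pos) : \sum_(y <- s) \sum_(w <- u) kap R (y - w) <=
      \sum_(y <- s) \sum_(w <- z :: u) kap R (y - w).
    apply: ler_sum => y _; rewrite big_cons; have := kap_ge0 R (y - z); lra.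
  have [->|u0] := eqVneq u [::].
    by rewrite /= /kapsum !big_nil !mulr0 addr0.
  case: (alive r u) => /=; last by rewrite mul0r addr0; apply: le_trans IH (mono _).
  case: (fresh u); last by rewrite mul0r mulr0 addr0; apply: le_trans IH (mono _).
  rewrite !mul1r big_cons addrC; apply: lerD; last by apply: le_trans IH (mono _).
  by rewrite /kapsum big_cons; have := kap_ge0 R (head 0 u - z); lra.
rewrite exchange_big /=.
apply: (@le_trans _ _ (\sum_(w <- u) 80 * rho%:R)); last first.
  by rewrite big_const_seq count_predT iter_addr_0 -[leLHS]mulr_natl lexx.
apply: ler_sum => w _.
have := @sum_kap R [seq z - w | z <- newsites r u] rho.
rewrite big_map; apply.
  by rewrite map_inj_uniq ?newsites_uniq //; exact: addIr.
by rewrite size_map (leq_trans (newsites_size r u)).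
Qed.

(** The sum over sites of the squared number of visits, written as a sum over times. *)
Definition visits2 (u : seq pos) : nat := \sum_(w <- u) count_mem w u.

Lemma visits2_cons y u : visits2 (y :: u) = (visits2 u + (count_mem y u).*2 + 1)%N.
Proof.
rewrite /visits2 big_cons /= eqxx.
have -> : (\sum_(w <- u) ((y == w) + count_mem w u) = count_mem y u + visits2 u)%N.
  rewrite big_split /=; congr (_ + _)%N.
  rewrite -sum1_count [RHS]big_mkcond; apply: eq_bigr => w _ /=. by rewrite eq_sym; case: (w == y).
by rewrite -/(visits2 u) /=; set a := count_mem y u; set b := visits2 u; rewrite add1n; lia.
Qed.

Lemma pairs_visits2 r z u : alive r u -> (pairs r (z :: u)).*2 = (visits2 u + size u)%N.
Proof.
elim: u z => [|y u IH] z au; first by rewrite /= /visits2 big_nil muln0.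
have au' : alive r u by exact: (@alive_cat r [:: y]).
rewrite visits2_cons [pairs _ _]/= -/(pairs r (y :: u)) au mul1n /= eqxx.
have /= h := IH y au'; rewrite doubleD h doubleD; move: (count_mem y u).*2 => c.
rewrite -addnA -[RHS]addnA -[in RHS](addnA (visits2 u)); lia.
Qed.

(** Cauchy-Schwarz, by expanding the sum of squared deviations of the visit numbers from their
    mean. *)
Lemma visits2_ge (u : seq pos) : ((size u) ^ 2 <= dist u * visits2 u)%N.
Proof.
have [->//|u0] := eqVneq u [::].
have D0 : (0 < dist u)%N.
  case: u u0 => // z u _; rewrite /dist.
  have : z \in undup (z :: u) by rewrite mem_undup mem_head.
  by case: (undup _).
have E1 (F : pos -> nat) : (\sum_(w <- u) F w = \sum_(w <- undup u) count_mem w u * F w)%N.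
  rewrite -big_undup_iterop_count; apply: eq_bigr => w _.
  by elim: (count_mem w u) => [//|[|k] IH]; rewrite ?mul1n // mulSn -IH.
have En : size u = (\sum_(w <- undup u) count_mem w u)%N.
  rewrite -sum1_size E1; apply: eq_bigr => w _; exact: muln1.
rewrite -(ler_nat R) natrX natrM.
set n : R := (size u)%:R; set D : R := (dist u)%:R; set T : R := (visits2 u)%:R.
have ED : \sum_(w <- undup u) (1 : R) = D.
  by rewrite big_const_seq count_predT iter_addr_0.
have EN : \sum_(w <- undup u) ((count_mem w u)%:R : R) = n by rewrite -natr_sum -En.
have ET : \sum_(w <- undup u) ((count_mem w u)%:R ^+ 2 : R) = T.
  rewrite /T /visits2 E1 natr_sum; apply: eq_bigr => w _.
  by rewrite natrM expr2.
have Dp : 0 < D by rewrite ltr0n.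
have : 0 <= \sum_(w <- undup u) (((count_mem w u)%:R - n / D) ^+ 2 : R).
  by apply: sumr_ge0 => w _; exact: sqr_ge0.
have sq (c : R) : \sum_(w <- undup u) (((count_mem w u)%:R - c) ^+ 2 : R) =
   T - 2 * c * n + c ^+ 2 * D.
  rewrite -ET -EN -[X in _ + _ * X]ED !mulr_sumr -sumrB -big_split /=.
  by apply: eq_bigr => w _; ring.
rewrite sq.
have -> : T - 2 * (n / D) * n + (n / D) ^+ 2 * D = (D * T - n ^+ 2) / D by field; rewrite gt_eqF.
by rewrite pmulr_lge0 ?invr_gt0 // subr_ge0.
Qed.

(** While fewer than [r] sites are visited, [visits2_ge] forces at least l^2 / (2 r) coincidences;
    otherwise only the bound on the drifts is kept. *)
Lemma compensator_ge (l r rho : nat) v : (r <= rho ^ 2)%N -> (0 < r)%N -> size v = l.+1 ->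
  (alive r v)%:R * (ln 2 * (l%:R ^+ 2 / (2 * r%:R))) - eps * (l.+1%:R * (80 * rho%:R))
  <= compensator r v.
Proof.
move=> rrho r0 sv; rewrite /compensator; apply: lerB; last first.
  by rewrite ler_wpM2l ?(ltW eps0) // -sv; exact: drifts_le.
have ln2 : 0 <= ln (2 : R) by rewrite ln_ge0 //; lra.
have [av|_] := boolP (alive r v); last by rewrite mul0r mulr_ge0.
rewrite mul1r ler_wpM2l // ler_pdivrMr ?mulr_gt0 ?ltr0n // -natrX -natrM -natrM ler_nat.
case: v av sv => // z u av [su].
have au : alive r u by exact: (@alive_cat r [:: z]).
have := pairs_visits2 z au; have := visits2_ge u; rewrite su.
move: au; rewrite /alive; set D := dist u; set T := visits2 u => h1 h2 h3.
have : (D * T <= r * T)%N by rewrite leq_mul2r ltnW ?orbT.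
by nia.
Qed.

Lemma reach_box n (c : pos) k (s v : seq pos) : (forall w : pos, w \in s -> `|w.1 - c.1| <= k%:Z /\ `|w.2 - c.2| <= k%:Z) ->
  s != [::] -> reach n s v ->
  (forall w : pos, w \in v -> `|w.1 - c.1| <= (k + n)%:Z /\ `|w.2 - c.2| <= (k + n)%:Z).
Proof.
elim: n k s => [|n IH] k s Hs s0.
  by move=> /= -> w /Hs; rewrite addn0.
move=> [e he /IH] /(_ k.+1); rewrite addSnnS; apply => //.
move=> w; rewrite inE => /orP[/eqP->|/Hs[]]; last by lia.
have : head 0 s \in s by case: s s0 {Hs} => // a s _; exact: mem_head.
move=> /Hs[]; have : `|e.1| <= 1 /\ `|e.2| <= 1.
  by move: he; rewrite !inE => /or4P[] /eqP->.
rewrite /=; lia.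
Qed.

Lemma int_close (a b z : int) (j l : nat) : `|a - z| <= j%:Z -> `|b - z| <= j%:Z ->
  (j <= l)%N -> `|b - a| <= (2 * l)%:Z.
Proof. lia. Qed.

Lemma Psi_le l z v j : (j <= l)%N -> reach j [:: z] v ->
  Psi v <= l.+1%:R * ln (1 + 8 * l%:R ^+ 2).
Proof.
move=> jl rv.
have sv := reach_size rv.
have HB : forall w, w \in v -> `|w.1 - z.1| <= j%:Z /\ `|w.2 - z.2| <= j%:Z.
  have := @reach_box j z 0 [:: z] v; rewrite add0n; apply => // w.
  by rewrite inE => /eqP->; rewrite !subrr.
have hv : head 0 v \in v by case: v sv {rv HB} => [|a v _]; rewrite ?addn1 // mem_head.
have L0 : 0 <= ln (1 + 8 * l%:R ^+ 2 : R).
  by rewrite ln_ge0 // lerDl mulr_ge0 // exprn_ge0.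
apply: (@le_trans _ _ (\sum_(w <- v) ln (1 + 8 * l%:R ^+ 2))); last first.
  rewrite big_const_seq count_predT iter_addr_0 sv -[leLHS]mulr_natl.
  by rewrite ler_wpM2r // ler_nat addn1.
rewrite /Psi big_seq [leRHS]big_seq; apply: ler_sum => w wv.
have [h1 h2] := HB _ wv; have [h3 h4] := HB _ hv.
have sq (a : int) : `|a| <= (2 * l)%:Z -> (a%:~R : R) ^+ 2 <= 4 * l%:R ^+ 2.
  move=> al; have : `|(a%:~R : R)| <= (2 * l)%:R.
    by rewrite -intr_norm -[leRHS]/((2 * l)%:Z%:~R) ler_int.
  move=> h; rewrite -real_normK ?num_real //.
  have -> : 4 * l%:R ^+ 2 = ((2 * l)%:R : R) ^+ 2 by rewrite natrM; ring.
  by rewrite lerXn2r ?nnegrE.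
have s1 := sq (head 0 v - w).1; have s2 := sq (head 0 v - w).2.
have p0 (x : R) : 0 <= x ^+ 2 := sqr_ge0 x.
rewrite /pot ler_ln ?posrE.
- have := s1 (int_close h1 h3 jl); have := s2 (int_close h2 h4 jl); lra.
- have := p0 ((head 0 v - w).1)%:~R; have := p0 ((head 0 v - w).2)%:~R; lra.
- have := p0 l%:R; lra.
Qed.

(** The mean of the compensator is bounded below by [compensator_ge] and above by [compensator_le]
    with [Psi_le]. *)
Lemma range_prob l r rho z : (r <= rho ^ 2)%N -> (1 < r)%N ->
  Ex d l [:: z] (fun v => (alive r v)%:R) * (ln 2 * (l%:R ^+ 2 / (2 * r%:R))) <=
  l.+1%:R * ln (1 + 8 * l%:R ^+ 2) + eps * (l.+1%:R * (80 * rho%:R)).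
Proof.
move=> rrho r1.
set c := ln 2 * _; set A := eps * _; set B := _ * ln (1 + _).
have -> : Ex d l [:: z] (fun v => (alive r v)%:R) * c =
  Ex d l [:: z] (fun v => c * (alive r v)%:R - A) + A.
  by rewrite ExB ExZ Ex_cst; ring.
rewrite lerD2r.
apply: (@le_trans _ _ (Ex d l [:: z] (compensator r))).
  apply: (Ex_le eps4 dpol) => v /reach_size; rewrite addn1 => sv.
  by rewrite mulrC; apply: compensator_ge => //; exact: ltnW.
apply: le_trans (@compensator_le r l [:: z] B _ _ _) _ => //.
  by move=> j v jl rv; exact: Psi_le rv.
have := Psi_ge0 [:: z]; rewrite /compensator /=.
rewrite /kapsum big_nil !mulr0 addr0 muln0 mulr0; lra.
Qed.

End Range.

(** * Displacement *)

(** Integer roots replace real powers of [n] in the decay estimates. *)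
Lemma root_floor (A n : nat) : (0 < A)%N -> exists j : nat, (j ^ A <= n < j.+1 ^ A)%N.
Proof.
move=> A0.
have P0 : exists j : nat, (j ^ A <= n)%N by exists 0%N; rewrite exp0n.
have ub j : (j ^ A <= n)%N -> (j <= n)%N.
  by move=> h; apply: leq_trans h; rewrite -{1}(expn1 j); case: j => // j; rewrite leq_pexp2l.
case: (ex_maxnP P0 ub) => j jn jmax; exists j; rewrite jn /= ltnNge.
by apply/negP => /jmax; rewrite ltnn.
Qed.

Definition left_of (k : int) : pred (seq pos) := fun v => (head 0 v).1 < k.

Section Displacement.
Variable R : realType.

Lemma ln2_ge : 2^-1 <= ln (2 : R).
Proof.
rewrite -[2]invrK lnV ?posrE; last by lra.
have -> : (2^-1 : R) = 1 + (- 2^-1) by lra.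
have := @le_ln1Dx R (- 2^-1) ltac:(lra); lra.
Qed.

Lemma ln_le_sub1 (x : R) : 0 < x -> ln x <= x - 1.
Proof.
move=> x0; have := @le_ln1Dx R (x - 1) ltac:(lra).
by have -> : 1 + (x - 1) = x by ring.
Qed.

(** From exp(-y) >= 1 - y and (1 + y + 2 y^2) (1 - y) = 1 + y^2 (1 - 2 y). *)
Lemma expR_le_quad (y : R) : y <= 2^-1 -> expR y <= 1 + y + 2 * y ^+ 2.
Proof.
move=> y2; have h := expR_ge1Dx (- y).
have p : 0 < 1 + - y by lra.
rewrite -[y in expR y]opprK expRN -[leRHS]invrK lef_pV2 ?posrE ?expR_gt0 //; last first.
  by rewrite invr_gt0; nra.
apply: le_trans h; rewrite -[leRHS]mul1r -ler_pdivrMr //.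
rewrite -invfM -[leRHS]invr1 lef_pV2 ?posrE //; nra.
Qed.

Variables (eps : R).
Hypotheses (eps0 : 0 < eps) (eps4 : eps < 4^-1).
Local Notation E := (Ex (erw eps)).

Let erwP : policy eps (erw eps).
Proof. by apply: erw_policy; exact: ltW. Qed.

(* Blocks of [m ^ A] steps visiting [m ^ B] sites: the estimate of the range
   requires [3 * B < 2 * A], and [A + 3 <= 2 * B] makes [m ^ B] at least [m] times
   the square root of the duration [m ^ A.+1] of [m] blocks. *)
Lemma block_prob (m : nat) (s : seq pos) : (864 <= m)%N -> s != [::] ->
  E (m ^ 13)%N s (fun v => (alive (m ^ 8) v)%:R) <= 2^-1.
Proof.
move=> m0; case: s => [//|z t] _.
rewrite -cat1s Ex_cat //.
(* The past [t] can only suppress drifts: a site already visited in the block is not fresh for the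
   whole walk. Hence [range_prob] applies whatever [t] is. *)
set d := fun v => erw eps (v ++ t).
have dP v : 0 <= d v <= eps * (fresh v)%:R.
  rewrite /d /erw; case: v => [|y v].
    by rewrite {2}/fresh /= mulr1; case: ifP => _; rewrite ?lexx ltW.
  rewrite /fresh /= mem_cat; case: (y \in v) => /=.
    by rewrite mulr0 lexx.
  by rewrite mulr1; case: ifP => _; rewrite ?lexx ltW.
have dpol : policy eps d by move=> v; exact: erwP.
apply: (@le_trans _ _ (Ex d (m ^ 13)%N [:: z] (fun v => (alive (m ^ 8) v)%:R))).
  apply: (Ex_le eps4 dpol) => v _; rewrite ler_nat.
  case: (boolP (alive _ (v ++ t))) => // /(leq_ltn_trans (dist_catl v t)).
  by rewrite /alive => ->.
have m1 : (1 < m)%N by apply: leq_trans m0.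
(* This will give p m^18 <= 432 m^17, and 864 = 2 * 432 makes p at most 1/2. *)
have := @range_prob R eps d eps0 eps4 dP (m ^ 13) (m ^ 8) (m ^ 4) z.
rewrite -expnM leqnn => /(_ isT).
rewrite -{1}(exp1n 8) ltn_exp2r // m1 => /(_ isT).
set p := Ex _ _ _ _; rewrite -[X in X * ln _]natr1 -[(m ^ 13).+1%:R]natr1 !natrX.
have x0 : (864 : R) <= m%:R by rewrite ler_nat.
set x : R := m%:R in x0 *.
have xk k : 1 <= x ^+ k by rewrite exprn_ege1 //; lra.
have lnb : ln (1 + 8 * (x ^+ 13) ^+ 2) <= 34 * x.
  apply: (@le_trans _ _ (ln (9 * x ^+ 26))).
    have x26 := xk 26%N; rewrite -exprM ler_ln ?posrE; lra.
  have xp : 0 < x by lra.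
  have x26 : 0 < x ^+ 26 by exact: exprn_gt0.
  have -> : ln (9 * x ^+ 26) = ln 9 + 26 * ln x by rewrite lnM ?posrE // lnXn // mulr_natl.
  have := @ln_le_sub1 9 ltac:(lra); have := @ln_le_sub1 x ltac:(lra); lra.
move=> H.
have H2 : p * (ln 2 * ((x ^+ 13) ^+ 2 / (2 * x ^+ 8))) <= 108 * x ^+ 17.
  apply: le_trans H _.
  have h1 : (x ^+ 13 + 1) * ln (1 + 8 * (x ^+ 13) ^+ 2) <= 68 * x ^+ 14.
    apply: (@le_trans _ _ ((x ^+ 13 + 1) * (34 * x))).
      by apply: ler_wpM2l => //; have := xk 13%N; lra.
    have -> : 68 * x ^+ 14 = (x ^+ 13 + x ^+ 13) * (34 * x) by rewrite [x ^+ 14]exprSr; ring.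
    by apply: ler_wpM2r; [lra|rewrite lerD2l].
  have h2 : eps * ((x ^+ 13 + 1) * (80 * x ^+ 4)) <= 40 * x ^+ 17.
    apply: (@le_trans _ _ (4^-1 * ((x ^+ 13 + x ^+ 13) * (80 * x ^+ 4)))).
      have a4 := xk 4%N; have a13 := xk 13%N.
      apply: ler_pM; [exact: ltW|by apply: mulr_ge0; lra|exact: ltW|].
      by apply: ler_wpM2r; lra.
    have -> : x ^+ 17 = x ^+ 13 * x ^+ 4 by rewrite -exprD.
    lra.
  have h3 : x ^+ 14 <= x ^+ 17 by rewrite ler_eXn2l //; lra.
  move: h1 h2; lra.
have p0 : 0 <= p by exact: Ex1_ge0 eps4 dpol _ _ _.
have : p * x ^+ 18 <= 432 * x ^+ 17.
  have e : (x ^+ 13) ^+ 2 / (2 * x ^+ 8) = 2^-1 * x ^+ 18.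
    rewrite -exprM (_ : (13 * 2 = 18 + 8)%N) // exprD.
    by field; lra.
  move: H2; rewrite e => H2.
  have : p * (2^-1 * (2^-1 * x ^+ 18)) <= p * (ln 2 * (2^-1 * x ^+ 18)).
    apply: ler_wpM2l => //; apply: ler_wpM2r; last exact: ln2_ge.
    by have := xk 18%N; lra.
  lra.
have -> : 432 * x ^+ 17 = (432 / x) * x ^+ 18.
  by rewrite [x ^+ 18]exprS; field; lra.
rewrite ler_pM2r; last by have := xk 18%N; lra.
move=> h; apply: le_trans h _; rewrite ler_pdivrMr; lra.
Qed.

(** The range never decreases, so if it is small at the end then every block saw few sites, each
    time with conditional probability at most 1/2. *)
Lemma blocks_prob (m k : nat) (s : seq pos) : (864 <= m)%N -> s != [::] ->
  E (k * m ^ 13)%N s (fun v => (alive (m ^ 8) v)%:R) <= 2^-1 ^+ k * (alive (m ^ 8) s)%:R.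
Proof.
move=> m0 s0; have [al|nal] := boolP (alive (m ^ 8) s); last first.
  rewrite mulr0 Ex_vanish // => a; case: (boolP (alive _ _)) => // /alive_cat.
  by rewrite (negbTE nal).
rewrite mulr1; elim: k s s0 al => [|k IH] s s0 al.
  rewrite expr0; exact: (Ex1_le1 eps4 erwP).
rewrite mulSn Ex_comp.
apply: (@le_trans _ _ (E (m ^ 13)%N s (fun v => 2^-1 ^+ k * (alive (m ^ 8) v)%:R))).
  apply: (Ex_le eps4 erwP) => v rv.
  have v0 : v != [::].
    by rewrite -size_eq0 (reach_size rv) addn_eq0 size_eq0 (negbTE s0) andbF.
  have [alv|nalv] := boolP (alive (m ^ 8) v); first by rewrite mulr1; exact: IH.
  rewrite mulr0 Ex_vanish // => a; case: (boolP (alive _ _)) => // /alive_cat.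
  by rewrite (negbTE nalv).
rewrite ExZ exprSr ler_wpM2l ?exprn_ge0 ?invr_ge0 //.
exact: block_prob.
Qed.

Lemma dist_prob (m n : nat) : (864 <= m)%N -> (m ^ 14 <= n)%N ->
  E n [:: 0] (fun v => (alive (m ^ 8) v)%:R) <= 2^-1 ^+ m.
Proof.
move=> m0 mn; rewrite -(subnKC mn) expnS Ex_comp.
have [al|nal] := boolP (alive (m ^ 8) [:: 0]); last first.
  by rewrite -expnS -Ex_comp Ex_vanish ?exprn_ge0 ?invr_ge0 // => a;
    case: (boolP (alive _ _)) => // /alive_cat; rewrite (negbTE nal).
have := @blocks_prob m m [:: 0] m0 isT; rewrite al mulr1; apply: le_trans.
apply: (Ex_le eps4 erwP) => v rv; apply: (Ex_ub eps4 erwP) => w /reach_cat[a _ ->].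
by rewrite ler_nat; case: (boolP (alive _ (a ++ v))) => // /alive_cat ->.
Qed.

(** The exponential of the martingale of the overview; [behead] appears because the drift at the
    current site has not acted yet. *)
Definition expdisp (lam : R) (v : seq pos) : R :=
  expR (- lam * ((head 0 v).1%:~R - 2 * eps * (dist (behead v))%:R)).

(** The exponent has mean zero, so only the quadratic term of [expR_le_quad] remains; [lam <= 3^-1]
    keeps the exponents at most 1/2. *)
Lemma avg_expdisp (lam a : R) : 0 <= lam <= 3^-1 -> 0 <= a < 4^-1 ->
  avg a (fun e => expR (- lam * (e.1%:~R - 2 * a))) <= 1 + 4 * lam ^+ 2.
Proof.
move=> /andP[l0 l3] /andP[a0 a4]; rewrite /avg /= !mulr0z mulr1z rmorphN1 !sub0r.
have la : 0 <= lam * a <= 12^-1 by apply/andP; split; nra.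
have h1 := @expR_le_quad (- lam * (1 - 2 * a)) ltac:(nra).
have h2 := @expR_le_quad (- lam * (- 1 - 2 * a)) ltac:(nra).
have h3 := @expR_le_quad (- lam * - (2 * a)) ltac:(nra).
have w1 : 0 <= 4^-1 + a by lra.
have w2 : 0 <= 4^-1 - a by lra.
have := ler_wpM2l w1 h1; have := ler_wpM2l w2 h2.
set e1 := expR _ in h1 *; set e2 := expR _ in h2 *; set e3 := expR _ in h3 *.
move=> H2 H1.
have : (4^-1 + a) * (1 + - lam * (1 - 2 * a) + 2 * (- lam * (1 - 2 * a)) ^+ 2) +
   (4^-1 - a) * (1 + - lam * (-1 - 2 * a) + 2 * (- lam * (-1 - 2 * a)) ^+ 2) +
   2^-1 * (1 + - lam * - (2 * a) + 2 * (- lam * - (2 * a)) ^+ 2) =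
   1 + lam ^+ 2 * (1 - 8 * a ^+ 2) by field.
have : lam ^+ 2 * (1 - 8 * a ^+ 2) <= lam ^+ 2 * 1.
  by apply: ler_wpM2l; [exact: sqr_ge0|have := sqr_ge0 a; lra].
have := sqr_ge0 lam; lra.
Qed.

Lemma expdisp_le (lam : R) n s : 0 <= lam <= 3^-1 -> s != [::] ->
  E n s (expdisp lam) <= (1 + 4 * lam ^+ 2) ^+ n * expdisp lam s.
Proof.
move=> l3; elim: n s => [|n IH] s s0; first by rewrite mul1r.
rewrite /=.
apply: (@le_trans _ _ (avg (erw eps s) (fun e => (1 + 4 * lam ^+ 2) ^+ n * expdisp lam s *
     expR (- lam * (e.1%:~R - 2 * erw eps s))))).
  apply: (avg_le eps4 (erwP s)) => e _; apply: le_trans (IH (move s e) isT) _.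
  rewrite -mulrA ler_wpM2l ?exprn_ge0 //; first by have := sqr_ge0 lam; lra.
  rewrite /expdisp /move /= -expRD (fresh_dist s0) rmorphD /= natrD.
  rewrite le_eqVlt; apply/orP; left; apply/eqP; congr expR.
  by rewrite /erw; case: (fresh s) => /=; ring.
rewrite avgZ [_ ^+ n.+1]exprSr -!mulrA ler_wpM2l ?exprn_ge0 //; first by have := sqr_ge0 lam; lra.
rewrite mulrC ler_wpM2r ?expR_ge0 //; apply: avg_expdisp => //.
have /andP[-> h] := erwP s; exact: le_lt_trans h eps4.
Qed.

(** Either fewer than m^8 sites are visited, or a first coordinate below m^7 makes [expdisp] large,
    and Markov's inequality applies. *)
Lemma displacement_aux : exists C c : R, [/\ 1 <= C, 0 < c &
  forall m n : nat, (m ^ 14 <= n <= (2 * m) ^ 14)%N ->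
  E n [:: 0] (fun v => (left_of (m ^ 7)%:Z v)%:R) <= C * expR (- c * m%:R)].
Proof.
pose c := eps / 64.
have c0 : 0 < c by rewrite divr_gt0.
have c12 : c <= 2^-1 by rewrite /c ler_pdivrMr //; apply: (le_trans (ltW eps4)); lra.
have le1 n (b : pred (seq pos)) : E n [:: 0] (fun v => (b v)%:R) <= 1 by exact: (Ex1_le1 eps4 erwP).
(* The three terms pay for a small range, for the exponential bound (6 = 4 + 2) and for [m] at most
   864, where the claim is trivial. *)
exists (1 + expR 6 + expR (c * 864)), c; split => //.
  by have := expR_gt0 (6 : R); have := expR_gt0 (c * 864); lra.
move=> m n /andP[mn nm].
have [m864|m864] := ltnP m 864.
  apply: le_trans (le1 _ _) _.
  apply: (@le_trans _ _ (expR (c * 864) * expR (- c * m%:R))).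
    rewrite -expRD -[leLHS]expR0 ler_expR.
    have ml : (m%:R : R) <= 864 by rewrite ler_nat ltnW.
    have := ler_wpM2l (ltW c0) ml; lra.
  by rewrite ler_wpM2r ?expR_ge0 //; have := expR_gt0 (6 : R); lra.
have x0 : (864 : R) <= m%:R by rewrite ler_nat.
set x : R := m%:R in x0 *.
have xk k : 1 <= x ^+ k by rewrite exprn_ege1 //; lra.
have x7 := xk 7%N.
(* Since n <= (2 m)^14 = 128^2 m^14, this gives lam^2 n <= 1, while 2 eps lam m^8 = eps m / 64
   yields the rate [c]. *)
pose lam := (128 * x ^+ 7)^-1.
have lam0 : 0 < lam by rewrite invr_gt0; lra.
have lam3 : 0 <= lam <= 3^-1.
  by rewrite ltW //= lef_pV2 ?posrE; lra.
pose C0 := expR (lam * (x ^+ 7 - 2 * eps * (x ^+ 8 - 1))).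
apply: (@le_trans _ _ (E n [:: 0] (fun v => (alive (m ^ 8) v)%:R + C0 * expdisp lam v))).
  apply: (Ex_le eps4 erwP) => v rv.
  have ed0 : 0 <= C0 * expdisp lam v by rewrite mulr_ge0 ?expR_ge0.
  case: (boolP (alive _ _)) => al; first by rewrite ler_wpDr // lern1; case: left_of.
  rewrite add0r /left_of; case: (ltP (head 0 v).1 (m ^ 7)%:Z) => // hx.
  rewrite /C0 /expdisp -expRD -[leLHS]expR0 ler_expR.
  (* The loss of 1 occurs when the current site is itself new. *)
  have hd : x ^+ 8 - 1 <= (dist (behead v))%:R.
    rewrite lerBlDr -natrX natr1 ler_nat.
    move: al; rewrite /alive -leqNgt => al; apply: leq_trans al _.
    rewrite fresh_dist; last by rewrite -size_eq0 (reach_size rv) addn1.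
    by rewrite -addn1 addnC leq_add2l; case: fresh.
  have hX : ((head 0 v).1%:~R : R) <= x ^+ 7.
    by rewrite -natrX -[leRHS]/((m ^ 7)%:Z%:~R) ler_int ltW.
  have h0 : eps * (x ^+ 8 - 1) <= eps * (dist (behead v))%:R by rewrite ler_wpM2l ?(ltW eps0).
  rewrite mulNr -mulrBr; apply: (mulr_ge0 (ltW lam0)).
  lra.
rewrite ExD ExZ.
have E1 : E n [:: 0] (fun v => (alive (m ^ 8) v)%:R) <= expR (- c * x).
  apply: le_trans (dist_prob m864 mn) _.
  rewrite -[2^-1 ^+ m]lnK ?posrE ?exprn_gt0 // ler_expR lnXn // lnV ?posrE // -[_ *+ m]mulr_natr.
  rewrite ler_wpM2r //; rewrite lerN2; exact: le_trans ln2_ge.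
have E2 : E n [:: 0] (expdisp lam) <= expR 4.
  apply: le_trans (@expdisp_le lam n [:: 0] lam3 isT) _.
  have -> : expdisp lam [:: 0] = 1.
    by rewrite /expdisp /= mulr0z /dist /= mulr0 subrr mulr0 expR0.
  rewrite mulr1.
  apply: (@le_trans _ _ (expR (4 * lam ^+ 2) ^+ n)).
    rewrite lerXn2r ?nnegrE ?expR_ge0 ?expR_ge1Dx //; have := sqr_ge0 lam; lra.
  rewrite -expRM_natl ler_expR.
  have nle : (n%:R : R) <= (128 * x ^+ 7) ^+ 2.
    have -> : (128 * x ^+ 7) ^+ 2 = ((2 * m) ^ 14)%:R.
      by rewrite natrX natrM -/x exprMn -exprM exprMn; congr (_ * _); ring.
    by rewrite ler_nat.
  have : lam ^+ 2 * n%:R <= 1.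
    rewrite /lam exprVn mulrC ler_pdivrMr ?mul1r // exprn_gt0 //; lra.
  lra.
have E3 : C0 <= expR 2 * expR (- c * x).
  rewrite -expRD ler_expR.
  have l7 : lam * x ^+ 7 = 128^-1 by rewrite /lam; field; lra.
  have l8 : lam * x ^+ 8 = 128^-1 * x by rewrite exprSr mulrA l7.
  have el : eps * lam <= 4^-1 * 1.
    by apply: ler_pM; rewrite ?ltW //; apply: le_lt_trans (_ : 3^-1 < 1); [case/andP: lam3|lra].
  rewrite /c; have -> : lam * (x ^+ 7 - 2 * eps * (x ^+ 8 - 1)) =
    lam * x ^+ 7 - 2 * eps * (lam * x ^+ 8) + 2 * (eps * lam) by ring.
  rewrite l7 l8.
  lra.
have C00 : 0 <= C0 by exact: expR_ge0.
have e6 : expR (6 : R) = expR 4 * expR 2 by rewrite -expRD; congr expR; lra.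
have : C0 * E n [:: 0] (expdisp lam) <= expR 6 * expR (- c * x).
  apply: le_trans (ler_wpM2l C00 E2) _.
  by rewrite e6 -mulrA mulrC ler_wpM2l ?expR_ge0.
have : 0 <= expR (c * 864) * expR (- c * x) by rewrite mulr_ge0 ?expR_ge0.
lra.
Qed.

(** Apply the previous lemma to the integer root [j] of [n]: if [j] is positive then n <= (2 j)^14,
    and the claim for [j] implies the one for [m <= j]. *)
Lemma displacement : exists C c : R, [/\ 0 < C, 0 < c &
  forall m n : nat, (m ^ 14 <= n)%N ->
  E n [:: 0] (fun v => (left_of (m ^ 7)%:Z v)%:R) <= C * expR (- c * m%:R)].
Proof.
have [C [c [C1 c0 H]]] := displacement_aux.
exists C, c; split => //; first lra.
move=> m n mn; have [j /andP[jn nj]] := root_floor n (isT : (0 < 14)%N).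
have mj : (m <= j)%N.
  by rewrite -ltnS -(@ltn_exp2r _ _ 14) //; exact: leq_ltn_trans mn nj.
have [j0|j0] := posnP j.
  move: mj; rewrite j0 leqn0 => /eqP->; rewrite mulr0 expR0 mulr1.
  by apply: le_trans C1; exact: (Ex1_le1 eps4 erwP).
apply: (@le_trans _ _ (C * expR (- c * j%:R))).
  have /H h : (j ^ 14 <= n <= (2 * j) ^ 14)%N.
    rewrite jn /= (leq_trans (ltnW nj)) // leq_exp2r // mul2n -addnn; lia.
  apply: le_trans h; apply: (Ex_le eps4 erwP) => v _; rewrite ler_nat /left_of.
  case: ltP => // /lt_le_trans hx; rewrite hx // lez_nat leq_exp2r //.
have C0 : 0 <= C by lra.
have mjR : (m%:R : R) <= j%:R by rewrite ler_nat.
rewrite ler_wpM2l // ler_expR; have := ler_wpM2l (ltW c0) mjR; lra.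
Qed.

End Displacement.

(** * Backtracking *)

Section Decay.
Variable R : realType.

(** Raise w <= exp w to the power B + 1, for w = c (j + 1) / (B + 1). *)
Lemma exp_poly (B : nat) (c : R) : 0 < c -> exists2 C : R, 0 < C &
  forall j : nat, j.+1%:R ^+ B <= C * expR (c * j%:R).
Proof.
move=> c0; pose b : R := B.+1%:R; have b0 : 0 < b by rewrite ltr0n.
have e z : expR (z * b) = expR z ^+ B.+1 by rewrite expRM_natr.
exists ((b / c) ^+ B.+1 * expR c).
  by rewrite mulr_gt0 ?expR_gt0 // exprn_gt0 // divr_gt0.
move=> j; set y : R := j.+1%:R.
have y1 : 1 <= y by rewrite ler1n.
apply: (@le_trans _ _ (y ^+ B.+1)); first exact: ler_weXn2l.
pose w := c * y / b.
have w0 : 0 <= w by rewrite divr_ge0 ?mulr_ge0 // ?ltW //; lra.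
have -> : y ^+ B.+1 = (b / c) ^+ B.+1 * w ^+ B.+1.
  by rewrite -exprMn; congr (_ ^+ _); rewrite /w; field; lra.
rewrite -mulrA -expRD.
have -> : c + c * j%:R = w * b by rewrite /w /y -natr1; field; lra.
have bc0 : 0 <= (b / c) ^+ B.+1 by rewrite exprn_ge0 // divr_ge0 // ltW.
rewrite e; apply: (ler_wpM2l bc0).
rewrite lerXn2r ?nnegrE ?expR_ge0 //.
by apply: le_trans (expR_ge1Dx _); lra.
Qed.

(** Decay of order exp(- c n^(1/A)), phrased with integer powers. *)
Definition stretched (a : nat -> R) (A : nat) :=
  exists C c : R, [/\ 0 < C, 0 < c &
    forall m n : nat, (m ^ A <= n)%N -> a n <= C * expR (- c * m%:R)].

Lemma expR_le_nat (c : R) (m j : nat) : 0 < c -> (m <= j)%N ->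
  expR (- c * j%:R) <= expR (- c * m%:R).
Proof.
move=> c0 mj; have mjR : (m%:R : R) <= j%:R by rewrite ler_nat.
by rewrite ler_expR; have := ler_wpM2l (ltW c0) mjR; lra.
Qed.

(** At the integer root [j] of [n], the factor is at most (j + 1)^(A B), which half of the
    exponential rate absorbs. *)
Lemma stretched_poly a A B : (0 < A)%N -> stretched a A ->
  exists C c : R, [/\ 0 < C, 0 < c & forall m n : nat, (m ^ A <= n)%N ->
    a n * n.+1%:R ^+ B <= C * expR (- c * m%:R)].
Proof.
move=> A0 [C [c [C0 c0 H]]]; have c20 : 0 < c / 2 by lra.
have [C1 C10 H1] := exp_poly (A * B) c20.
exists (C * C1), (c / 2); split => //; first exact: mulr_gt0.
move=> m n mn; have [j /andP[jn nj]] := root_floor n A0.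
have mj : (m <= j)%N by rewrite -ltnS -(@ltn_exp2r _ _ A) //; exact: leq_ltn_trans mn nj.
have nB : (n.+1%:R ^+ B : R) <= j.+1%:R ^+ (A * B).
  by rewrite exprM lerXn2r ?nnegrE ?exprn_ge0 // -natrX ler_nat.
have B0 : 0 <= (n.+1%:R ^+ B : R) by rewrite exprn_ge0.
apply: (@le_trans _ _ (C * expR (- c * j%:R) * n.+1%:R ^+ B)).
  by rewrite ler_wpM2r // H.
apply: (@le_trans _ _ (C * expR (- c * j%:R) * (C1 * expR (c / 2 * j%:R)))).
  apply: ler_wpM2l; last exact: le_trans nB (H1 j).
  by rewrite mulr_ge0 ?expR_ge0 ?(ltW C0).
rewrite mulrACA -expRD; apply: ler_wpM2l; first by rewrite mulr_ge0 ?ltW.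
have -> : - c * j%:R + c / 2 * j%:R = - (c / 2) * j%:R by field.
exact: expR_le_nat.
Qed.

Lemma sum_inv_sq (h k : nat) :
  \sum_(0 <= i < k) ((h + i).+2%:R ^+ 2)^-1 <= (1 : R).
Proof.
apply: (@le_trans _ _ (1 - (k.+1%:R)^-1)); last by rewrite gerBl.
elim: k => [|k IH]; first by rewrite big_geq // invr1 subrr.
rewrite big_nat_recr //=.
have k0 := ler0n R k.
have h1 : (((h + k).+2%:R ^+ 2)^-1 : R) <= (k.+1%:R * k.+2%:R)^-1.
  rewrite lef_pV2 ?posrE ?exprn_gt0 ?mulr_gt0 // -natrX -natrM ler_nat; nia.
have h2 : ((k.+1%:R * k.+2%:R)^-1 : R) = k.+1%:R^-1 - k.+2%:R^-1.
  by rewrite -[k.+2%:R]natr1 -[k.+1%:R]natr1; field; lra.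
by rewrite h2 in h1; apply: le_trans (lerD IH h1) _; rewrite addrA subrK lexx.
Qed.

End Decay.

(** * The probability of never stepping left of the start *)

Lemma int_step_le (a e : int) (n H : nat) :
  a + n.+1%:Z <= H%:Z -> -1 <= e <= 1 -> a + e + n%:Z <= H%:Z.
Proof. lia. Qed.

Lemma int_step_exit (a e : int) : 0 <= a -> -1 <= e <= 1 -> a + e < 0 -> a + e = -1.
Proof. lia. Qed.

Section Survival.
Variable R : realType.
Variables (eps : R).
Hypotheses (eps0 : 0 < eps) (eps4 : eps < 4^-1).
Local Notation E := (Ex (erw eps)).

Let erwP : policy eps (erw eps).
Proof. by apply: erw_policy; exact: ltW. Qed.

Definition survival (n : nat) : R := E n [:: 0] (fun v => (x_ge 0 v)%:R).

(** Gambler's ruin: (x + 1) / (H + 1) is a submartingale, vanishes when the walk exits at -1, and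
    stays at most 1 because the remaining steps cannot lead beyond [H]. *)
Lemma survival_ge_aux (H n : nat) (s : seq pos) : s != [::] -> x_ge 0 s ->
  (head 0 s).1 + n%:Z <= H%:Z ->
  ((head 0 s).1%:~R + 1) / H.+1%:R <= E n s (fun v => (x_ge 0 v)%:R).
Proof.
elim: n s => [|n IH] s s0 sx hH.
  rewrite /= sx ler_pdivrMr // mul1r -natr1 lerD2r.
  by rewrite -[leRHS]/(H%:Z%:~R) ler_int; rewrite addr0 in hH.
have x0 : 0 <= (head 0 s).1 by case: s s0 sx {hH} => // z s _ /= /andP[].
set x : R := (head 0 s).1%:~R.
have xR : 0 <= x by rewrite ler0z.
have step : avg (erw eps s) (fun e : pos => (x + e.1%:~R + 1) / H.+1%:R) <=
    E n.+1 s (fun v => (x_ge 0 v)%:R).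
  rewrite /=; apply: (avg_le eps4 (erwP s)) => e he.
  have e1 : -1 <= e.1 <= 1 by move: he; rewrite !inE => /or4P[] /eqP->.
  have -> : x + e.1%:~R = (head 0 (move s e)).1%:~R :> R by rewrite /= rmorphD.
  have [ge0|lt0] := leP 0 (head 0 (move s e)).1.
    apply: IH => //; first by rewrite /= ge0.
    exact: int_step_le hH e1.
  have -> : (head 0 (move s e)).1 = -1 by exact: int_step_exit x0 e1 lt0.
  rewrite rmorphN1 addNr mul0r; exact: (Ex1_ge0 eps4 erwP).
apply: le_trans step; rewrite /avg /= !mulr0z mulr1z rmorphN1.
have /andP[a0 _] := erwP s; move: a0; set a := erw eps s => a0.
rewrite -subr_ge0.
have -> : (4^-1 + a) * ((x + 1 + 1) / H.+1%:R) + (4^-1 - a) * ((x + -1 + 1) / H.+1%:R) +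
   4^-1 * ((x + 0 + 1) / H.+1%:R) + 4^-1 * ((x + 0 + 1) / H.+1%:R) - (x + 1) / H.+1%:R =
   2 * a / H.+1%:R.
  by rewrite -[H.+1%:R]natr1; field; have := ler0n R H; lra.
by rewrite divr_ge0 // mulr_ge0.
Qed.

Lemma survival_ge (n : nat) : n.+1%:R^-1 <= survival n.
Proof.
have := @survival_ge_aux n n [:: 0] isT isT.
by rewrite add0r lexx => /(_ isT); rewrite /= mulr0z add0r mul1r.
Qed.

Lemma survivalS (n : nat) :
  survival n = E n.+1 [:: 0] (fun v => (x_ge 0 (behead v))%:R).
Proof.
rewrite -addn1 Ex_comp; apply: Ex_eq => v _ /=.
by rewrite avg_cst.
Qed.

Lemma survival_diff (n : nat) :
  survival n - survival n.+1 <= E n.+1 [:: 0] (fun v => (left_of 0 v)%:R).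
Proof.
rewrite survivalS -ExB; apply: (Ex_le eps4 erwP) => v _.
case: v => [|z v] /=; first by rewrite subrr.
rewrite /left_of /=; case: (x_ge 0 v); last by rewrite andbF subrr ler0n.
by rewrite andbT; case: (ltP z.1 0) => _; rewrite ?subr0 ?subrr.
Qed.

Lemma survival_mono (n k : nat) : survival (n + k) <= survival n.
Proof.
elim: k => [|k IH]; first by rewrite addn0.
rewrite addnS; apply: le_trans IH; rewrite [leRHS]survivalS.
by apply: (Ex_le eps4 erwP) => -[|z v] _ //=; rewrite ler_nat; case: (0 <= z.1).
Qed.

Lemma left_of_stretched : stretched (fun n => E n [:: 0] (fun v => (left_of 0 v)%:R)) 14.
Proof.
have [C [c [C0 c0 H]]] := displacement eps0 eps4.
exists C, c; split => // m n mn; apply: le_trans (H m n mn).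
apply: (Ex_le eps4 erwP) => v _; rewrite ler_nat /left_of.
case: ltP => // /lt_le_trans hx; rewrite hx //.
Qed.

(** Each one-step loss is at most the probability of standing left of 0, whose decay still beats the
    inverse squares that make the losses summable. *)
Lemma survival_tail : exists C c : R, [/\ 0 < C, 0 < c &
  forall m h k : nat, (m ^ 14 <= h)%N -> survival h - survival (h + k) <= C * expR (- c * m%:R)].
Proof.
have [C [c [C0 c0 H]]] := stretched_poly 2 (isT : (0 < 14)%N) left_of_stretched.
exists C, c; split => // m h k mh.
apply: (@le_trans _ _ (\sum_(0 <= i < k) C * expR (- c * m%:R) * ((h + i).+2%:R ^+ 2)^-1)).
  elim: k => [|k IH]; first by rewrite addn0 subrr big_geq.
  rewrite big_nat_recr //= addnS.
  have h1 := survival_diff (h + k).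
  have h2 : E (h + k).+1 [:: 0] (fun v => (left_of 0 v)%:R) <=
      C * expR (- c * m%:R) * ((h + k).+2%:R ^+ 2)^-1.
    rewrite ler_pdivlMr ?exprn_gt0 //; apply: H.
    by apply: leq_trans mh _; rewrite -addnS leq_addr.
  rewrite -[survival h](subrK (survival (h + k))) -addrA.
  exact: lerD IH (le_trans h1 h2).
rewrite -mulr_sumr -[leRHS]mulr1 ler_wpM2l //; last exact: sum_inv_sq.
by rewrite mulr_ge0 ?expR_ge0 ?ltW.
Qed.

(** With h = m^14, [survival_ge] is polynomial in 1/m whereas the loss after time [h] is
    exponentially small; for large [m] at least half of 1 / (h + 1) is never lost. *)
Lemma survival_pos : exists2 p : R, 0 < p <= 1 & forall n, p <= survival n.
Proof.
have [C [c [C0 c0 H]]] := survival_tail.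
have [C1 C10 H1] := exp_poly 15 c0.
have [m mC] : exists m : nat, 2 * C * C1 <= m.+1%:R.
  exists (Num.truncn (2 * C * C1)).
  by apply: ltW; apply: truncnS_gt; rewrite ?mulr_ge0 ?ltW.
pose h := (m ^ 14)%N; pose p : R := (2 * h.+1%:R)^-1.
have p0 : 0 < p by rewrite invr_gt0 mulr_gt0.
have ph : p * 2 <= survival h.
  apply: le_trans (survival_ge h).
  by rewrite /p invfM mulrAC mulVf ?mul1r.
have tail : C * expR (- c * m%:R) <= p.
  have hm : (h.+1%:R : R) <= m.+1%:R ^+ 14.
    by rewrite -natrX ler_nat /h ltn_exp2r.
  rewrite /p -div1r ler_pdivlMr ?mulr_gt0 //.
  have := H1 m; rewrite exprSr => h1.
  have e : expR (- c * m%:R) * expR (c * m%:R) = 1.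
    by rewrite -expRD mulNr addNr expR0.
  have h0 := expR_gt0 (- c * m%:R).
  have h2 : m.+1%:R ^+ 14 * m.+1%:R * expR (- c * m%:R) <= C1.
    have <- : C1 * expR (c * m%:R) * expR (- c * m%:R) = C1.
      by rewrite -mulrA [expR (c * _) * _]mulrC e mulr1.
    by rewrite ler_wpM2r // ltW.
  have m0 : (0 : R) < m.+1%:R by [].
  have h3 : h.+1%:R * (2 * C * C1) * expR (- c * m%:R) <= C1.
    apply: le_trans h2; rewrite ler_wpM2r ?(ltW h0) //; apply: ler_pM => //.
    by rewrite !mulr_ge0 ?(ltW C0) ?(ltW C10).
  have : C1 * (2 * h.+1%:R * (C * expR (- c * m%:R))) <= C1 * 1 by lra.
  by rewrite ler_pM2l // mulrC.
exists p.
  have h1 : (1 : R) <= h.+1%:R by rewrite ler1n.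
  by rewrite p0 invf_le1 ?mulr_gt0 //; lra.
move=> n; have [nh|/ltnW hn] := leqP n h.
  by rewrite -(subnKC nh) in ph; have := survival_mono n (h - n); lra.
have := H m h (n - h)%N (leqnn _); rewrite subnKC // => hh.
lra.
Qed.

End Survival.

(** * Trajectories without a cut *)

Definition gtx : rel pos := fun p q => q.1 < p.1.

(* As histories are reversed, [drop i v] is the earlier part of [v]. *)
Definition nocut (v : seq pos) : bool :=
  all (fun i => ~~ allrel gtx (take i v) (drop i v)) (iota 1 (size v).-1).

Definition cutlev (L : int) (v : seq pos) : bool :=
  has (fun i => x_ge L (take i v) && x_lt L (drop i v)) (iota 0 (size v).+1).

(** The base case makes the walk end at or beyond the level following the last one tested, so that
    each level is certainly passed. *)
Fixpoint nocutlevs (h J : nat) (L : int) (v : seq pos) : bool :=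
  if J is J'.+1 then ~~ cutlev L v && nocutlevs h J' (L + h%:Z) v
  else L <= (head 0 v).1.

Lemma nocutlevs_ge h J L v : nocutlevs h J L v -> L + (J * h)%:Z <= (head 0 v).1.
Proof.
elim: J L => [|J IH] L /=; first by rewrite addr0.
by move=> /andP[_ /IH]; rewrite mulSn PoszD addrA.
Qed.

(** The origin is left of [L] and the current site is not, so neither part is empty and a cut at
    level [L] would be a genuine cut. *)
Lemma nocut_cutlev v L : nocut v -> 0 \in v -> 0 < L -> L <= (head 0 v).1 ->
  ~~ cutlev L v.
Proof.
move=> nc v0 L0 Lv; apply/negP => /hasP[i].
rewrite mem_iota add0n ltnS => /andP[_ ile] /andP[tL dL].
have i0 : (0 < i)%N.
  case: i tL dL {ile} => // _; rewrite drop0; case: v v0 Lv {nc} => // z v _ /= Lz /andP[zL _].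
  by move: (lt_le_trans zL Lz); rewrite ltxx.
have iv : (i < size v)%N.
  rewrite ltnNge; apply/negP => vi; move: tL; rewrite take_oversize // => /allP/(_ _ v0) /=.
  by rewrite leNgt L0.
move/allP: nc => /(_ i); rewrite mem_iota i0 /= add1n prednK ?iv; last exact: leq_trans iv.
move=> /(_ isT) /negP; apply; apply/allrelP => p q pt qd.
exact: lt_le_trans (allP dL q qd) (allP tL p pt).
Qed.

Lemma nocut_nocutlevs h J L v : nocut v -> 0 \in v -> 0 < L ->
  L + (J * h)%:Z <= (head 0 v).1 -> nocutlevs h J L v.
Proof.
move=> nc v0; elim: J L => [|J IH] L L0 /=; first by rewrite addr0.
rewrite mulSn PoszD addrA => HL.
rewrite nocut_cutlev // ?IH //; first by rewrite ltr_wpDr.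
by apply: le_trans HL; rewrite -addrA lerDl.
Qed.

Section NoCut.
Variable R : realType.
Variables (eps : R).
Hypotheses (eps0 : 0 < eps) (eps4 : eps < 4^-1).
Local Notation E := (Ex (erw eps)).

Let erwP : policy eps (erw eps).
Proof. by apply: erw_policy; exact: ltW. Qed.

Lemma x_lt_trans (L M : int) t : L <= M -> x_lt L t -> x_lt M t.
Proof. by move=> LM; apply: sub_all => p /lt_le_trans; apply. Qed.

Lemma step_x (e : pos) : e \in dirs -> -1 <= e.1 <= 1.
Proof. by rewrite !inE => /or4P[] /eqP->. Qed.

(** Steps change the first coordinate by at most 1, so the half-plane is entered exactly at [L],
    where the bound is known; a walk that never enters it is not in [ev]. *)
Lemma first_passage (b : R) (L : int) (ev : pred (seq pos)) : 0 <= b ->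
  (forall v, ev v -> L <= (head 0 v).1) ->
  (forall n z t, z.1 = L -> x_lt L t -> E n (z :: t) (fun v => (ev v)%:R) <= b) ->
  forall n z t, z.1 <= L -> x_lt L t -> E n (z :: t) (fun v => (ev v)%:R) <= b.
Proof.
move=> b0 evL H; elim=> [|n IH] z t zL tL.
all: move: zL; rewrite le_eqVlt => /orP[/eqP zL|zL]; first exact: H.
  rewrite /=; case: (boolP (ev _)) => // /evL /=.
  by rewrite leNgt zL.
rewrite /= -[leRHS](avg_cst (erw eps (z :: t))).
apply: (avg_le eps4 (erwP _)) => e he; apply: IH; last by rewrite /= zL.
have := step_x he; move: zL; rewrite /=.
move: (z.1) (e.1) => a c; lia.
Qed.

Lemma reach_below n s w M : s != [::] -> (head 0 s).1 <= M -> x_lt M (behead s) ->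
  reach n s w -> (head 0 w).1 <= M + n%:Z /\ x_lt (M + n%:Z) (behead w).
Proof.
elim: n s M => [|n IH] s M s0 hM bM /=; first by move=> ->; rewrite addr0.
move=> [e he /IH] /(_ (M + 1) isT).
have -> : M + n.+1%:Z = M + 1 + n%:Z by rewrite -addn1 PoszD addrA addrAC.
apply.
  have := step_x he; move: hM => /=; move: ((head 0 s).1) (e.1) => a c; lia.
case: s s0 hM bM => // z s _ /= hM bM; rewrite (le_lt_trans hM) ?ltrDl //=.
by apply: x_lt_trans bM; rewrite lerDl.
Qed.

Lemma Ex_stay n (z : pos) t : x_lt z.1 t ->
  E n (z :: t) (fun v => (x_ge z.1 (take (size v - size t) v))%:R) = survival eps n.
Proof.
move=> tz; rewrite Ex_record //; last first.
  by move=> v nv; rewrite size_cat addnK take_size_cat // (negbTE nv).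
apply: Ex_eq => v _; rewrite size_cat addnK take_size_cat //.
congr (nat_of_bool _)%:R; rewrite /x_ge all_map; apply: eq_all => p /=.
by rewrite lerDr.
Qed.

(** From the first passage at a level, the walk backtracks within [h] steps (probability at most 1 -
    p, then the next level is tried), or only later (at most [q]), or never, which is a cut. If b
    bounds the case [J], then q + b (1 - p) is the bound for [J.+1]. *)
Lemma nocutlevs_prob (p q : R) (h : nat) :
  0 < p <= 1 -> 0 <= q -> p <= survival eps h ->
  (forall k, survival eps h - survival eps (h + k) <= q) ->
  forall J n z t, x_lt z.1 t ->
    E n (z :: t) (fun v => (nocutlevs h J z.1 v)%:R) <= (1 - p) ^+ J + q / p.
Proof.
move=> /andP[p0 p1] q0 ph hq; elim=> [|J IH] n z t tz.
  rewrite expr0; apply: le_trans (Ex1_le1 eps4 erwP _ _ _) _.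
  by rewrite lerDl divr_ge0 // ltW.
set b := _ ^+ J + _ in IH.
have b0 : 0 <= b by rewrite addr_ge0 ?divr_ge0 ?exprn_ge0 ?subr_ge0 // ltW.
have b'0 : 0 <= (1 - p) ^+ J.+1 + q / p.
  by rewrite addr_ge0 ?divr_ge0 ?exprn_ge0 ?subr_ge0 // ltW.
(* In fewer than [h] steps the walk cannot reach the next level, so the event is empty. *)
have [nh|hn] := ltnP n h.
  rewrite (_ : E _ _ _ = 0) // -(Ex_cst (erw eps) n (z :: t) 0); apply: Ex_eq => v rv.
  case: (boolP (nocutlevs _ _ _ _)) => // /nocutlevs_ge.
  have /andP[_] := reach_x rv; rewrite mulSn PoszD /=.
  move: (z.1) ((head 0 v).1) => a c; move: (J * h)%N => d; lia.
rewrite -(subnKC hn); move: (n - h)%N => k {n hn}; rewrite Ex_comp.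
pose ge v := x_ge z.1 (take (size v - size t) v).
have geE a : ge (a ++ t) = x_ge z.1 a by rewrite /ge size_cat addnK take_size_cat.
have ge_cut a : ge (a ++ t) -> cutlev z.1 (a ++ t).
  rewrite geE => ga; apply/hasP; exists (size a).
    by rewrite mem_iota size_cat add0n leq0n ltnS leq_addr.
  by rewrite take_size_cat // drop_size_cat // ga.
apply: (@le_trans _ _ (E h (z :: t) (fun w => (ge w)%:R - E k w (fun v => (ge v)%:R)
    + b * (1 - (ge w)%:R)))).
  apply: (Ex_le eps4 erwP) => w rw.
  have [a _ ew] := reach_cat rw.
  have {}ew : w = rcons a z ++ t by rewrite cat_rcons.
  have [gw|ngw] := boolP (ge w).
    rewrite subrr mulr0 addr0 -[X in X - _](Ex_cst (erw eps) k w) -ExB.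
    apply: (Ex_le eps4 erwP) => v /reach_cat[c _ ev].
    rewrite ev ew catA /=; case: (boolP (ge _)) => [/ge_cut ->|_] /=; first by rewrite subrr.
    by rewrite subr0 lern1; case: (_ && _).
  have -> : E k w (fun v => (ge v)%:R) = 0.
    apply: Ex_vanish => c; rewrite ew catA geE /x_ge all_cat.
    by move: ngw; rewrite ew geE /x_ge => /negbTE ->; rewrite andbF.
  rewrite subrr add0r subr0 mulr1.
  apply: (@le_trans _ _ (E k w (fun v => (nocutlevs h J (z.1 + h%:Z) v)%:R))).
    apply: (Ex_le eps4 erwP) => v _; rewrite ler_nat /=.
    by case: (~~ cutlev _ _); rewrite //= leq0n.
  (* After [h] steps the walk is at most at the next level and its past strictly below it, as
     [first_passage] requires. *)
  have [hw bw] := @reach_below h (z :: t) w z.1 isT (lexx _) tz rw.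
  case: w hw bw ew {rw ngw} => [|y w] /= hw bw ew; first by case: (a) ew.
  apply: (@first_passage b (z.1 + h%:Z) (nocutlevs h J (z.1 + h%:Z)) b0 _ _ k y w hw bw).
    by move=> v /nocutlevs_ge; apply: le_trans; rewrite lerDl.
  by move=> n' z' t' <-; exact: IH.
rewrite ExD ExB -Ex_comp ExZ ExB Ex_cst.
rewrite (Ex_stay _ tz) (Ex_stay _ tz).
apply: (@le_trans _ _ (q + b * (1 - p))).
  by apply: lerD; [exact: hq|rewrite ler_wpM2l // lerB].
rewrite /b mulrDl -exprSr mulrBr mulr1 divfK ?gt_eqF //; lra.
Qed.

Definition nocut_prob (n : nat) : R := E n [:: 0] (fun v => (nocut v)%:R).

(* [42 = 3 * 14]: after [m ^ 42] steps the walk is to the right of [m ^ 21], so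
   it has passed the [m] levels [m ^ 14, 2 * m ^ 14, ...]. *)
Lemma nocut_stretched : stretched nocut_prob 42.
Proof.
have [p /andP[p0 p1] hp] := survival_pos eps0 eps4.
have [C1 [c1 [C10 c10 H1]]] := displacement eps0 eps4.
have [C2 [c2 [C20 c20 H2]]] := survival_tail eps0 eps4.
pose c := Num.min c1 (Num.min c2 p).
have c0 : 0 < c by rewrite !lt_min c10 c20.
have cm (c' : R) (m : nat) : c <= c' -> expR (- c' * m%:R) <= expR (- c * m%:R).
  by move=> cc; rewrite ler_expR !mulNr lerN2 ler_wpM2r.
exists (C1 + 1 + C2 / p + expR (c * 2)), c; split => //.
  have := expR_gt0 (c * 2); have := divr_gt0 C20 p0; lra.
move=> m n mn.
have e0 := expR_ge0 (- c * m%:R).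
have C2p := ltW (divr_gt0 C20 p0).
have [m2|m2] := ltnP m 2.
  apply: le_trans (Ex1_le1 eps4 erwP _ _ _) _.
  apply: (@le_trans _ _ (expR (c * 2) * expR (- c * m%:R))).
    rewrite -expRD -[leLHS]expR0 ler_expR.
    have ml : (m%:R : R) <= 2 by rewrite ler_nat ltnW.
    have := ler_wpM2l (ltW c0) ml; lra.
  by rewrite ler_wpM2r //; lra.
(* With this spacing, [survival_tail] makes a late return exponentially unlikely in [m]. *)
pose h := (m ^ 14)%N.
apply: (@le_trans _ _ (E n [:: 0] (fun v => (left_of ((m ^ 3) ^ 7)%N%:Z v)%:R +
    (nocutlevs h m h%:Z v)%:R))).
  apply: (Ex_le eps4 erwP) => v rv.
  case: (boolP (nocut v)) => nc; last by rewrite addr_ge0.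
  have [lv|nlv] := boolP (left_of _ v); first by rewrite lerDl.
  rewrite add0r nocut_nocutlevs //.
  - by have [a _ ->] := reach_cat rv; rewrite mem_cat inE eqxx orbT.
  - by rewrite ltz_nat expn_gt0; case: (m) m2.
  - move: nlv; rewrite /left_of -leNgt; apply: le_trans.
    rewrite -PoszD lez_nat /h -expnM -expnS.
    apply: (@leq_trans (m ^ 15 + m ^ 15)); first by rewrite leq_add2r leq_pexp2l //; exact: ltnW.
    rewrite addnn -mul2n (@leq_trans (m ^ 16)) //; first by rewrite [(m ^ 16)%N]expnS leq_mul2r m2 orbT.
    by rewrite leq_pexp2l //; exact: ltnW.
rewrite ExD.
have h1 : E n [:: 0] (fun v => (left_of ((m ^ 3) ^ 7)%N%:Z v)%:R) <= C1 * expR (- c * m%:R).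
  apply: (@le_trans _ _ (C1 * expR (- c1 * (m ^ 3)%N%:R))).
    by apply: H1; rewrite -expnM.
  rewrite ler_wpM2l ?(ltW C10) //; apply: (@le_trans _ _ (expR (- c1 * m%:R))).
    by apply: expR_le_nat => //; rewrite -{1}(expn1 m) leq_pexp2l //; exact: ltnW.
  by apply: cm; rewrite ge_min lexx.
pose q := C2 * expR (- c2 * m%:R).
have q0 : 0 <= q by rewrite mulr_ge0 ?expR_ge0 ?ltW.
have h2 : E n [:: 0] (fun v => (nocutlevs h m h%:Z v)%:R) <= (1 - p) ^+ m + q / p.
  apply: (@first_passage _ h%:Z) => //.
  - by rewrite addr_ge0 ?exprn_ge0 ?subr_ge0 // divr_ge0 // ltW.
  - by move=> v /nocutlevs_ge; apply: le_trans; rewrite lerDl.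
  - move=> n' z t zh tz; rewrite -zh; apply: nocutlevs_prob; rewrite ?p0 ?zh //.
    by move=> k; exact: H2.
have h3 : (1 - p) ^+ m <= expR (- c * m%:R).
  apply: (@le_trans _ _ (expR (- p * m%:R))); last by apply: cm; rewrite !ge_min lexx !orbT.
  rewrite expRM_natr lerXn2r ?nnegrE ?subr_ge0 ?expR_ge0 //.
  by have := expR_ge1Dx (- p); lra.
have h4 : q / p <= C2 / p * expR (- c * m%:R).
  rewrite /q mulrAC ler_wpM2l //.
  by apply: cm; rewrite !ge_min lexx orbT.
have := expR_ge0 (c * 2); have := expR_ge0 (- c * m%:R) => x1 x2.
have := mulr_ge0 x2 x1; lra.
Qed.

End NoCut.

(** * The renewal structure *)

(* [firstcut s v]: the earliest cut of the trajectory [v] is at time [s]. *)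
Definition firstcut (s : nat) (v : seq pos) : bool :=
  nocut (drop (size v - s) v) && allrel gtx (take (size v - s) v) (drop (size v - s) v).

Lemma nocutP (v : seq pos) i : nocut v -> (0 < i < size v)%N ->
  ~~ allrel gtx (take i v) (drop i v).
Proof.
move=> /allP h /andP[i0 iv]; apply: h; rewrite mem_iota i0 add1n prednK //.
exact: leq_trans iv.
Qed.

(** The earliest cut has the largest index; a further cut inside the earlier part would combine with
    it into a cut of larger index. *)
Lemma firstcut_exists (v : seq pos) : ~~ nocut v ->
  exists2 s, (0 < s < size v)%N & firstcut s v.
Proof.
rewrite -has_predC => /hasP[i0]; rewrite mem_iota /= negbK => i0v c0.
pose P i := [&& (0 < i)%N, (i < size v)%N & allrel gtx (take i v) (drop i v)].
have vpos : (0 < size v)%N by case: (size v) i0v => [|k]; rewrite //=; lia.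
have P0 : exists i, P i.
  exists i0; rewrite /P c0 andbT; move: i0v; rewrite add1n prednK //.
have Pb i : P i -> (i <= size v)%N by case/and3P => _ /ltnW.
case: (ex_maxnP P0 Pb) => i /and3P[ipos iv ic] imax.
exists (size v - i)%N; first by lia.
rewrite /firstcut subKn ?(ltnW iv) // ic andbT; apply/allP => j; rewrite mem_iota.
move=> jt; apply/negP => jc.
have jlt : (0 < j < size v - i)%N by move: jt; rewrite size_drop; lia.
have /imax : P (i + j)%N; last by lia.
apply/and3P; split; [lia|lia|].
rewrite takeD addnC -drop_drop allrel_catl jc andbT.
apply/allrelP => p q pt qd; apply: (allrelP ic) => //.
exact: mem_drop qd.
Qed.

Lemma firstcut_lt (v : seq pos) s s' : (0 < s)%N -> (s < s')%N -> (s' < size v)%N ->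
  firstcut s v -> firstcut s' v -> false.
Proof.
move=> s0 ss' s'v /andP[_ c] /andP[nc _].
have := nocutP (i := (s' - s)%N) nc; rewrite size_drop => /(_ ltac:(lia)) /negP; case.
have e : (size v - s = (size v - s') + (s' - s))%N by lia.
move: c; rewrite e takeD allrel_catl => /andP[_].
by rewrite addnC -drop_drop.
Qed.

Lemma sum_bool_le1 (R : numDomainType) (b : pred nat) N :
  (forall i j, (0 < i)%N -> (i < j)%N -> (j < N.+1)%N -> b i -> b j -> false) ->
  \sum_(1 <= s < N.+1) (b s)%:R <= 1 :> R.
Proof.
elim: N => [|N IH] H; first by rewrite big_geq.
rewrite big_nat_recr //=; case bN: (b N.+1); last first.
  by rewrite addr0; apply: IH => i j i0 ij jN; apply: H => //; exact: leqW.
rewrite big_nat big1 ?add0r // => i /andP[i0 iN].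
by case bi: (b i) => //; have := H i N.+1 i0 iN (ltnSn _) bi bN.
Qed.

Lemma subz1S (k : nat) : k.+1%:Z - 1 = k%:Z.
Proof. lia. Qed.

Section Renewal.
Variable R : realType.
Variables (eps : R).
Hypotheses (eps0 : 0 < eps) (eps4 : eps < 4^-1).
Local Notation E := (Ex (erw eps)).

Let erwP : policy eps (erw eps).
Proof. by apply: erw_policy; exact: ltW. Qed.

(** The part of [firstcut] that is already decided when the cut occurs. *)
Definition record (v : seq pos) : bool :=
  nocut (behead v) && x_lt (head 0 v).1 (behead v).

Definition renewal_weight (A : pred (seq pos)) (s : nat) : R :=
  E s [:: 0] (fun v => (A v && record v)%:R).

(** Restricted to [x_ge 0] because after a cut the walk never steps back. *)
Definition slow (k : int) (n : nat) : R :=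
  E n [:: 0] (fun v => (x_ge 0 v && left_of k v)%:R).

Lemma reach_head n s v : (0 < n)%N -> reach n s v ->
  exists2 e, e \in dirs & head 0 v = head 0 (behead v) + e.
Proof.
case: n => // n _; rewrite -addn1 => /reach_split[v' _ /= [e he ->]].
by exists e.
Qed.

Lemma reach_nonempty n s v : s != [::] -> reach n s v -> v != [::].
Proof.
by move=> s0 rv; rewrite -size_eq0 (reach_size rv) addn_eq0 size_eq0 (negbTE s0) andbF.
Qed.

(** As steps change the first coordinate by at most 1, a site strictly right of the one before [z]
    is at or right of [z]. So a cut splits into a condition on the past and one on the future. *)
Lemma firstcut_cat (s : nat) (a t : seq pos) (z : pos) : (0 < s)%N ->
  reach s [:: 0] (z :: t) ->
  firstcut s (a ++ z :: t) = record (z :: t) && x_ge z.1 (rcons a z).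
Proof.
move=> s0 rz.
have st : size t = s by have := reach_size rz; rewrite /= addn1 => -[].
have -> : a ++ z :: t = rcons a z ++ t by rewrite cat_rcons.
rewrite /firstcut size_cat st addnK take_size_cat // drop_size_cat //.
rewrite /record /= -andbA; congr andb.
have [e he /= zt] := reach_head s0 rz.
have t0 : head 0 t \in t by case: t st s0 {rz zt} => [<-//|y t _ _]; exact: mem_head.
apply/idP/idP => [c|/andP[tz az]].
  apply/andP; split.
    by apply/allP => q qt; apply: (allrelP c) => //; rewrite mem_rcons mem_head.
  apply/allP => p pa; have := allrelP c p _ pa t0; rewrite /gtx.
  have := step_x he; rewrite zt /=.
  move: (p.1) ((head 0 t).1) (e.1) => x y w; lia.
by apply/allrelP => p q pa qt; exact: lt_le_trans (allP tz _ qt) (allP az _ pa).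
Qed.

Lemma left_of_map (k : int) (z : pos) u : u != [::] ->
  left_of k [seq w + z | w <- u] = left_of (k - z.1) u.
Proof. by case: u => // w u _; rewrite /left_of /= ltrBrDr. Qed.

Lemma Ex_after_record (b : pred (seq pos)) (c : pred (seq pos)) n (z : pos) t :
  x_lt z.1 t -> (forall u, u != [::] -> b ([seq w + z | w <- u] ++ t) = c u) ->
  E n (z :: t) (fun v => (x_ge z.1 (take (size v - size t) v) && b v)%:R) =
  E n [:: 0] (fun v => (x_ge 0 v && c v)%:R).
Proof.
move=> tz bc; rewrite Ex_record //; last first.
  by move=> v nv; rewrite size_cat addnK take_size_cat // (negbTE nv).
apply: Ex_eq => v rv; rewrite size_cat addnK take_size_cat //.
rewrite bc; last exact: reach_nonempty rv.
congr (nat_of_bool (_ && _))%:R; rewrite /x_ge all_map; apply: eq_all => p /=.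
by rewrite lerDr.
Qed.

Lemma slow_mono k k' n : k <= k' -> slow k n <= slow k' n.
Proof.
move=> kk; apply: (Ex_le eps4 erwP) => v _; rewrite ler_nat.
by case: (x_ge 0 v) => //=; rewrite /left_of; case: ltP => // /lt_le_trans ->.
Qed.

Lemma slow_le1 k n : slow k n <= 1.
Proof. exact: (Ex1_le1 eps4 erwP). Qed.

Lemma renewal_weight_ge0 A s : 0 <= renewal_weight A s.
Proof. exact: (Ex1_ge0 eps4 erwP). Qed.

Lemma renewal_weight_le A s : renewal_weight A s.+1 <= nocut_prob eps s.
Proof.
rewrite /renewal_weight -addn1 Ex_comp; apply: (Ex_le eps4 erwP) => v _.
apply: (Ex_ub eps4 erwP) => w /= [e _ ->]; rewrite /record /= ler_nat.
by case: (nocut v); rewrite ?andbF //=; case: (A _ && _).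
Qed.

(** The origin is strictly left of the cut, so seen from there the level [k] is at most [k - 1]. *)
Lemma firstcut_weight (A : pred (seq pos)) (s n : nat) k : (0 < s)%N ->
  (forall a v, A (a ++ v) -> A v) ->
  E (s + n) [:: 0] (fun v => [&& A v, left_of k v & firstcut s v]%:R) <=
  renewal_weight A s * slow (k - 1) n.
Proof.
move=> s0 AS; rewrite Ex_comp /renewal_weight mulrC -ExZ.
apply: (Ex_le eps4 erwP) => w rw; rewrite mulrC.
case: w rw => [/reach_size|z t rw]; first by rewrite addn1.
have st : size t = s by have := reach_size rw; rewrite /= addn1 => -[].
case: (boolP (A (z :: t) && record (z :: t))) => [/andP[_ rec]|nA] /=; last first.
  rewrite mul0r (_ : E _ _ _ = 0) // Ex_vanish // => a.
  rewrite firstcut_cat //; move: nA; rewrite negb_and => /orP[nA|/negbTE ->]; last by rewrite !andbF.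
  by case: (boolP (A (a ++ _))) => // /AS; rewrite (negbTE nA).
rewrite mul1r.
have tz : x_lt z.1 t by case/andP: rec.
have z1 : 1 <= z.1.
  have [a _ e] := reach_cat rw.
  have : 0 \in t.
    case: a e => [[_ te]|y a [_ ->]]; first by move: s0; rewrite -st te.
    by rewrite mem_cat inE eqxx orbT.
  by move=> /(allP tz) /=; rewrite -gtz0_ge1.
apply: le_trans (slow_mono n (_ : k - z.1 <= k - 1)); last by rewrite lerB.
rewrite /slow -(@Ex_after_record (left_of k) (left_of (k - z.1)) n z t tz); last first.
  move=> u u0; rewrite -left_of_map //; by case: u u0.
apply: (Ex_le eps4 erwP) => v /reach_cat[a _ ->].
rewrite firstcut_cat // rec /= ler_nat.
have -> : a ++ z :: t = rcons a z ++ t by rewrite cat_rcons.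
rewrite size_cat addnK take_size_cat //.
by case: (A _); case: (left_of _ _); case: (x_ge _ _).
Qed.

Lemma renewal_ub (A : pred (seq pos)) (N : nat) k :
  (forall a v, A (a ++ v) -> A v) ->
  E N [:: 0] (fun v => (A v && left_of k v)%:R) <=
  nocut_prob eps N + \sum_(1 <= s < N.+1) renewal_weight A s * slow (k - 1) (N - s).
Proof.
move=> AS.
apply: (@le_trans _ _ (E N [:: 0] (fun v => (nocut v)%:R +
   \sum_(1 <= s < N.+1) [&& A v, left_of k v & firstcut s v]%:R))).
  apply: (Ex_le eps4 erwP) => v rv.
  have S0 (B : pred nat) : 0 <= \sum_(1 <= s < N.+1) (B s)%:R :> R.
    by apply: sumr_ge0 => s _; exact: ler0n.
  have := S0 (fun s => [&& A v, left_of k v & firstcut s v]).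
  case: (boolP (A v)) => Av /= SS; last by rewrite addr_ge0.
  move: SS; case: (boolP (left_of k v)) => lv /= SS; last by rewrite addr_ge0.
  case: (boolP (nocut v)) => [_|/firstcut_exists[s sv sc]]; first by rewrite lerDl.
  rewrite add0r (bigD1_seq s) ?iota_uniq //=; last first.
    by rewrite mem_index_iota; move: sv; rewrite (reach_size rv) /= addn1.
  by rewrite sc lerDl; apply: sumr_ge0 => i _; exact: ler0n.
rewrite ExD lerD2l Ex_sum; rewrite !big_nat; apply: ler_sum => s /andP[s0 sN].
by rewrite -{1}(subnKC (sN : (s <= N)%N)); exact: firstcut_weight.
Qed.

(** Multiply by [survival N <= survival (N - s)]: each product is at most the probability of staying
    in the half-plane with first cut at [s]. These events are disjoint, inside one of probability
    [survival N]. The weights thus act as the law of a gap between cuts. *)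
Lemma renewal_weight_sum (N : nat) :
  \sum_(1 <= s < N.+1) renewal_weight (x_ge 0) s <= 1.
Proof.
have [p /andP[p0 _] hp] := survival_pos eps0 eps4.
have sN : 0 < survival eps N := lt_le_trans p0 (hp N).
rewrite -(ler_pM2r sN) mul1r mulr_suml.
apply: (@le_trans _ _ (E N [:: 0] (fun v => \sum_(1 <= s < N.+1)
   (x_ge 0 v && firstcut s v)%:R))); last first.
  apply: (Ex_le eps4 erwP) => v rv; case: (x_ge 0 v); last by rewrite big1.
  apply: sum_bool_le1 => i j i0 ij jN; apply: firstcut_lt => //.
  by rewrite (reach_size rv) /= addn1.
rewrite Ex_sum !big_nat; apply: ler_sum => s /andP[s0 sN'].
have sN1 : (s <= N)%N by [].
apply: (@le_trans _ _ (renewal_weight (x_ge 0) s * survival eps (N - s))).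
  rewrite ler_wpM2l ?renewal_weight_ge0 // -{1}(subnK sN1).
  exact: survival_mono.
rewrite -{2}(subnKC sN1) Ex_comp /renewal_weight mulrC -ExZ.
apply: (Ex_le eps4 erwP) => w rw; rewrite mulrC.
case: w rw => [/reach_size|z t rw]; first by rewrite addn1.
case: (boolP (x_ge 0 (z :: t) && record (z :: t))) => [/andP[zt rec]|_]; last first.
  by rewrite mul0r; exact: (Ex1_ge0 eps4 erwP).
rewrite mul1r.
have tz : x_lt z.1 t by case/andP: rec.
rewrite -(Ex_stay eps (N - s) tz).
apply: (Ex_le eps4 erwP) => v /reach_cat[a _ ->].
rewrite firstcut_cat // rec /= ler_nat.
have -> : a ++ z :: t = rcons a z ++ t by rewrite cat_rcons.
rewrite size_cat addnK take_size_cat //.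
case: (boolP (x_ge _ _)) => // az; rewrite andbT.
have [z0 t0] : 0 <= z.1 /\ x_ge 0 t by apply/andP; exact: zt.
have a0 : x_ge 0 (rcons a z) by apply: sub_all az => y; exact: le_trans.
by rewrite {1}/x_ge all_cat [all _ (rcons a z)]a0 [all _ t]t0.
Qed.

Lemma slow0 n : slow 0 n = 0.
Proof.
rewrite /slow -(Ex_cst (erw eps) n [:: 0] 0); apply: Ex_eq => -[|z v] /reach_size //= _.
by rewrite /left_of /= leNgt; case: (z.1 < 0); rewrite ?andbF.
Qed.

(** A Chernoff bound for [k] gaps truncated at [b], by induction over the first cut; [G] pays for
    each missing or overlong gap. *)
Lemma slow_le (lam K G : R) (b : nat) : 0 <= lam -> 0 <= K -> 0 <= G ->
  \sum_(1 <= s < b.+1) renewal_weight (x_ge 0) s * expR (lam * s%:R) <= expR (lam * K) ->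
  (forall N, (b < N)%N -> nocut_prob eps N +
     \sum_(b.+1 <= s < N.+1) renewal_weight (x_ge 0) s <= G) ->
  forall k N : nat, slow k%:Z N <= expR (lam * (K * k%:R + b%:R - N%:R)) + k%:R * G.
Proof.
move=> lam0 K0 G0 Hb HG; elim=> [|k IH] N.
  by rewrite slow0 mul0r addr0 expR_ge0.
(* For [N <= b] the exponent is nonnegative and the bound trivial: this is what [b] is for in it. *)
have [Nb|bN] := leqP N b.
  apply: le_trans (slow_le1 _ _) _.
  have : 1 <= expR (lam * (K * k.+1%:R + b%:R - N%:R)).
    rewrite -[leLHS]expR0 ler_expR mulr_ge0 // -addrA addr_ge0 ?mulr_ge0 //.
    by rewrite subr_ge0 ler_nat.
  move=> h; apply: le_trans h _; rewrite lerDl mulr_ge0 //.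
have AS : forall a v, x_ge 0 (a ++ v) -> x_ge 0 v by move=> a v; rewrite /x_ge all_cat => /andP[].
have := renewal_ub N k.+1%:Z AS; rewrite -/(slow _ _) => H; apply: le_trans H _.
rewrite subz1S.
rewrite (big_cat_nat (n := b.+1)) //=; last exact: ltnW.
have h1 : \sum_(1 <= s < b.+1) renewal_weight (x_ge 0) s * slow k%:Z (N - s) <=
    expR (lam * (K * k.+1%:R + b%:R - N%:R)) + k%:R * G.
  apply: (@le_trans _ _ (\sum_(1 <= s < b.+1) (expR (lam * (K * k%:R + b%:R - N%:R)) *
     (renewal_weight (x_ge 0) s * expR (lam * s%:R)) + k%:R * G * renewal_weight (x_ge 0) s))).
    rewrite !big_nat; apply: ler_sum => s /andP[s0 sb].
    have sN : (s <= N)%N by apply: leq_trans (ltnW bN).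
    apply: le_trans (ler_wpM2l (renewal_weight_ge0 _ _) (IH (N - s)%N)) _.
    rewrite natrB // mulrDr [renewal_weight _ _ * (k%:R * G)]mulrC lerD2r.
    rewrite mulrCA -expRD le_eqVlt; apply/orP; left; apply/eqP.
    by congr (_ * expR _); ring.
  rewrite big_split -!mulr_sumr /=; apply: lerD.
    apply: le_trans (ler_wpM2l (expR_ge0 _) Hb) _.
    rewrite -expRD ler_expR -natr1 le_eqVlt; apply/orP; left; apply/eqP; ring.
  by rewrite -[leRHS]mulr1 ler_wpM2l ?renewal_weight_sum // mulr_ge0.
have h2 : \sum_(b.+1 <= s < N.+1) renewal_weight (x_ge 0) s * slow k%:Z (N - s) <=
    \sum_(b.+1 <= s < N.+1) renewal_weight (x_ge 0) s.
  by apply: ler_sum => s _; rewrite ler_piMr ?renewal_weight_ge0 ?slow_le1.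
have h3 := HG _ bN.
have : k.+1%:R * G = k%:R * G + G by rewrite -natr1 mulrDl mul1r.
move: h1 h2 h3; set S1 := \sum_(1 <= s < _) _; set S2 := \sum_(b.+1 <= s < _) (_ * _).
set S3 := \sum_(b.+1 <= s < _) _; lra.
Qed.

End Renewal.

(** * Linear speed *)

Section Speed.
Variable R : realType.
Variables (eps : R).
Hypotheses (eps0 : 0 < eps) (eps4 : eps < 4^-1).
Local Notation E := (Ex (erw eps)).

Let erwP : policy eps (erw eps).
Proof. by apply: erw_policy; exact: ltW. Qed.

Local Notation g := (nocut_prob eps).

Let g0 n : 0 <= g n.
Proof. exact: (Ex1_ge0 eps4 erwP). Qed.

(** Of three spare powers of n + 1, one is for a first moment and two are for summability. *)
Lemma nocut_moment : exists D c : R, [/\ 0 < D, 0 < c & forall m n : nat, (m ^ 42 <= n)%N ->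
  g n * n.+1%:R <= D * expR (- c * m%:R) * (n.+2%:R ^+ 2)^-1].
Proof.
have [C [c [C0 c0 H]]] := stretched_poly 3 (isT : (0 < 42)%N) (nocut_stretched eps0 eps4).
exists (4 * C), c; split => //; first by rewrite mulr_gt0.
move=> m n mn; rewrite ler_pdivlMr ?exprn_gt0 //.
rewrite -mulrA; apply: (@le_trans _ _ (4 * (g n * n.+1%:R ^+ 3))); last first.
  by rewrite ler_wpM2l // H.
rewrite [leRHS]mulrCA -[leLHS]mulrA; apply: ler_wpM2l => //.
have -> : n.+2%:R = n.+1%:R + 1 :> R by rewrite natr1.
have : 1 <= n.+1%:R :> R by rewrite ler1n.
move: (n.+1%:R) => x x1; rewrite [x ^+ 3]exprS [leRHS]mulrCA ler_wpM2l //; first lra; nra.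
Qed.

Lemma truncated_weights (D c : R) (A : pred (seq pos)) : 0 < D ->
  (forall m n : nat, (m ^ 42 <= n)%N ->
    g n * n.+1%:R <= D * expR (- c * m%:R) * (n.+2%:R ^+ 2)^-1) ->
  (forall N, \sum_(1 <= s < N.+1) renewal_weight eps A s * s%:R <= D) /\
  (forall m b N, (m ^ 42 <= b)%N -> (b <= N)%N ->
    \sum_(b.+1 <= s < N.+1) renewal_weight eps A s <= D * expR (- c * m%:R)).
Proof.
move=> D0 H; split=> [N|m b N mb bN].
  rewrite big_add1 /=.
  apply: (@le_trans _ _ (\sum_(0 <= i < N) D * ((0 + i).+2%:R ^+ 2)^-1)).
    apply: ler_sum => i _; rewrite add0n.
    have := H 0%N i isT; rewrite mulr0 expR0 mulr1; apply: le_trans.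
    by rewrite ler_wpM2r //; exact: renewal_weight_le.
  by rewrite -mulr_sumr -[leRHS]mulr1 ler_wpM2l ?(ltW D0) //; exact: sum_inv_sq.
have C0 : 0 <= D * expR (- c * m%:R) by rewrite mulr_ge0 ?expR_ge0 ?ltW.
rewrite big_add1 -[b]add0n big_addn /=.
apply: (@le_trans _ _ (\sum_(0 <= i < N - b) D * expR (- c * m%:R) * ((b + i).+2%:R ^+ 2)^-1)).
  apply: ler_sum => i _; rewrite addnC.
  apply: le_trans (H m (b + i)%N _); last by apply: leq_trans mb (leq_addr _ _).
  apply: le_trans (renewal_weight_le eps0 eps4 A _) _.
  by rewrite ler_peMr // ler1n.
by rewrite -mulr_sumr -[leRHS]mulr1 ler_wpM2l //; exact: sum_inv_sq.
Qed.

Lemma speed_aux : exists K C c : R, [/\ 0 < K, 0 < C, 0 < c &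
  forall m n k : nat, (0 < m)%N -> (m ^ 45 <= n < m.+1 ^ 45)%N -> (k <= n)%N ->
  K * k%:R <= n%:R / 2 ->
  E n [:: 0] (fun v => (left_of k.+1%:Z v)%:R) <= C * expR (- c * m%:R)].
Proof.
have [D [c [D0 c0 H]]] := nocut_moment.
have [M1 T1] := truncated_weights (x_ge 0) D0 H.
have [M2 T2] := truncated_weights predT D0 H.
have c20 : 0 < c / 2 by rewrite divr_gt0.
have [C5 C50 H5] := exp_poly 45 c20.
pose c' := Num.min (c / 2) 4^-1.
have c'0 : 0 < c' by rewrite lt_min divr_gt0 //=; lra.
exists (2 * D), (2 * D + D * (expR 1 + 2 * D * C5)), c'; split => //.
- by rewrite mulr_gt0.
- by rewrite addr_gt0 ?mulr_gt0 // addr_gt0 ?expR_gt0 ?mulr_gt0.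
move=> m n k m0 /andP[mn nm] kn Kk.
pose b := (m ^ 42)%N.
have b0 : (0 < b)%N by rewrite expn_gt0 m0.
have bn : (b <= n)%N by apply: leq_trans mn; rewrite leq_pexp2l.
have bR : (0 : R) < b%:R by rewrite ltr0n.
(* The truncation is at m^42 and n >= m^45, so lam n >= m^3 / 2. *)
pose lam : R := (2 * b%:R)^-1.
have lam0 : 0 < lam by rewrite invr_gt0 mulr_gt0.
have lamb : lam * b%:R = 2^-1 by rewrite /lam invfM mulfVK // gt_eqF.
pose e := expR (- c * m%:R).
have e0 : 0 <= e by exact: expR_ge0.
have De : 0 <= D * e by rewrite mulr_ge0 // ltW.
have gb N : (b <= N)%N -> g N <= D * e.
  move=> bN; have := H m N bN => h.
  apply: (@le_trans _ _ (g N * N.+1%:R)); first by rewrite ler_peMr // ler1n.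
  by apply: le_trans h _; rewrite ler_piMr // invf_le1 ?exprn_gt0 // exprn_ege1 // ler1n.
have w0 := renewal_weight_ge0 eps0 eps4.
(* As lam s <= 1/2, exp(lam s) <= 1 + 2 lam s; the first moment being at most [D], this is where K =
   2 D comes from. *)
have S1 : \sum_(1 <= s < b.+1) renewal_weight eps (x_ge 0) s * expR (lam * s%:R)
    <= expR (lam * (2 * D)).
  apply: le_trans (expR_ge1Dx _).
  apply: (@le_trans _ _ (\sum_(1 <= s < b.+1) (renewal_weight eps (x_ge 0) s +
      2 * lam * (renewal_weight eps (x_ge 0) s * s%:R)))).
    rewrite !big_nat; apply: ler_sum => s /andP[s0 sb].
    have sbR : (s%:R : R) <= b%:R by rewrite ler_nat.
    have ls0 : 0 <= lam * s%:R by rewrite mulr_ge0 // ltW.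
    have ls1 : lam * s%:R <= 2^-1 by rewrite -lamb ler_wpM2l // ltW.
    have ex : expR (lam * s%:R) <= 1 + 2 * (lam * s%:R).
      by apply: le_trans (expR_le_quad ls1) _; nra.
    apply: le_trans (ler_wpM2l (w0 _ _) ex) _.
    by rewrite mulrDr mulr1 lerD2l le_eqVlt; apply/orP; left; apply/eqP; ring.
  rewrite big_split /= -mulr_sumr; apply: lerD; first exact: renewal_weight_sum.
  have -> : lam * (2 * D) = 2 * lam * D by ring.
  by rewrite ler_wpM2l // mulr_ge0 // ltW.
have G0 : 0 <= 2 * (D * e) by rewrite mulr_ge0.
have HG : forall M, (b < M)%N -> g M + \sum_(b.+1 <= s < M.+1) renewal_weight eps (x_ge 0) s <= 2 * (D * e).
  move=> M bN; have h1 := gb M (ltnW bN); have h2 := T1 m b M (leqnn _) (ltnW bN).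
  by rewrite mulr2n mulrDl mul1r; exact: lerD.
have slowb := slow_le eps0 eps4 (ltW lam0) (ltW (mulr_gt0 (ltr0Sn R 1) D0)) G0 S1 HG.
have ub : E n [:: 0] (fun v => (left_of k.+1%:Z v)%:R) <= g n +
    \sum_(1 <= s < n.+1) renewal_weight eps predT s * slow eps (k.+1%:Z - 1) (n - s).
  exact: (@renewal_ub R eps eps0 eps4 predT n k.+1%:Z (fun _ _ _ => isT)).
apply: le_trans ub _.
rewrite subz1S.
rewrite (big_cat_nat (n := b.+1)) //=.
pose B := expR 1 * expR (- c' * m%:R) + k%:R * (2 * (D * e)).
have B0 : 0 <= B by apply: addr_ge0; apply: mulr_ge0 => //; exact: expR_ge0.
(* Before the first cut the walk may go left, hence [predT]; the total of these weights is bounded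
   by their first moment. *)
have h1 : \sum_(1 <= s < b.+1) renewal_weight eps predT s * slow eps k%:Z (n - s) <= D * B.
  apply: (@le_trans _ _ (\sum_(1 <= s < b.+1) (renewal_weight eps predT s * s%:R) * B)).
    rewrite !big_nat; apply: ler_sum => s /andP[s0 sb].
    have sbR : (s%:R : R) <= b%:R by rewrite ler_nat.
    apply: (@le_trans _ _ (renewal_weight eps predT s * B)); last first.
      by rewrite ler_wpM2r // ler_peMr // ler1n.
    rewrite ler_wpM2l //; apply: le_trans (slowb k (n - s)%N) _.
    rewrite lerD2r -expRD ler_expR natrB; last exact: leq_trans bn.
    have nb : m%:R <= lam * n%:R * 2.
      have : (m ^ 3 * b <= n)%N by rewrite /b -expnD.
      rewrite -(ler_nat R) natrM => h.
      apply: (@le_trans _ _ ((m ^ 3)%N%:R)); first by rewrite ler_nat -{1}(expn1 m) leq_pexp2l.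
      rewrite -(ler_pM2r bR); apply: le_trans h _.
      have -> : lam * n%:R * 2 * b%:R = (lam * b%:R) * (2 * n%:R) by ring.
      by rewrite lamb mulrA mulVf ?mul1r // pnatr_eq0.
    have h3 : lam * (2 * D * k%:R) <= lam * (n%:R / 2) by rewrite ler_wpM2l // ltW.
    have h4 : lam * s%:R <= lam * b%:R by rewrite ler_wpM2l // ltW.
    have h5 : c' * m%:R <= 4^-1 * m%:R by rewrite ler_wpM2r // ge_min lexx orbT.
    have -> : lam * (2 * D * k%:R + b%:R - (n%:R - s%:R)) =
      lam * (2 * D * k%:R) + lam * b%:R - lam * n%:R + lam * s%:R by ring.
    lra.
  by rewrite -mulr_suml ler_wpM2r.
have h2 : \sum_(b.+1 <= s < n.+1) renewal_weight eps predT s * slow eps k%:Z (n - s) <= D * e.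
  apply: le_trans (T2 m b n (leqnn _) bn).
  by apply: ler_sum => s _; rewrite ler_piMr ?slow_le1.
have h3 := gb n bn.
have ee : e <= expR (- c' * m%:R).
  rewrite ler_expR !mulNr lerN2 ler_wpM2r //; apply: (@le_trans _ _ (c / 2)); last by lra.
  by rewrite ge_min lexx.
(* The factor k <= n < (m + 1)^45 is polynomial in [m] and costs half of the rate. *)
have ke : k%:R * e <= C5 * expR (- c' * m%:R).
  apply: (@le_trans _ _ (C5 * expR (c / 2 * m%:R) * e)).
    rewrite ler_wpM2r //; apply: le_trans (H5 m).
    by rewrite -natrX ler_nat (leq_trans kn) // ltnW.
  rewrite -mulrA ler_wpM2l ?(ltW C50) // -expRD ler_expR -mulrDl mulNr.
  have -> : (c / 2 + - c) * m%:R = - (c / 2 * m%:R) by field.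
  by rewrite lerN2 ler_wpM2r // ge_min lexx.
have DD : 0 <= D := ltW D0.
have h4 : D * B <= D * (expR 1 + 2 * D * C5) * expR (- c' * m%:R).
  rewrite -mulrA ler_wpM2l // mulrDl lerD2l.
  have -> : k%:R * (2 * (D * e)) = 2 * D * (k%:R * e) by ring.
  by rewrite -[2 * D * C5 * _]mulrA ler_wpM2l // mulr_ge0.
have h5 : D * e <= D * expR (- c' * m%:R) by rewrite ler_wpM2l.
move: h1 h2; set X1 := \sum_(1 <= s < _) _; set X2 := \sum_(b.+1 <= s < _) _.
lra.
Qed.

Definition speed_below (c : R) (n : nat) : pred (seq pos) :=
  fun v => (head 0 v).1%:~R <= c * n%:R.

Lemma speed : exists s C c : R, [/\ 0 < s, 0 < C, 0 < c &
  forall m n : nat, (m ^ 45 <= n)%N ->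
  E n [:: 0] (fun v => (speed_below s n v)%:R) <= C * expR (- c * m%:R)].
Proof.
have [K [C [c [K0 C0 c0 H]]]] := speed_aux.
(* For k the integer part of s n, this gives both K k <= n / 2 and k <= n. *)
pose s := (2 * (K + 1))^-1.
have s0 : 0 < s by rewrite invr_gt0 mulr_gt0 // addr_gt0.
exists s, (C + 1), c; split => //; first by rewrite addr_gt0.
move=> m n mn; have [j /andP[jn nj]] := root_floor n (isT : (0 < 45)%N).
have mj : (m <= j)%N.
  by rewrite -ltnS -(@ltn_exp2r _ _ 45) //; exact: leq_ltn_trans mn nj.
have [j0|j0] := posnP j.
  move: mj; rewrite j0 leqn0 => /eqP->; rewrite mulr0 expR0 mulr1.
  by apply: le_trans (Ex1_le1 eps4 erwP _ _ _) _; lra.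
apply: (@le_trans _ _ (C * expR (- c * j%:R))); last first.
  apply: ler_pM => //; rewrite ?expR_ge0 ?(ltW C0) //; first lra.
  exact: expR_le_nat.
pose k := Num.truncn (s * n%:R).
have sn0 : 0 <= s * n%:R by rewrite mulr_ge0 // ltW.
have /andP[k1 k2] := truncn_itv sn0.
have s1 : s * (2 * (K + 1)) = 1 by rewrite mulVf // gt_eqF // mulr_gt0 // addr_gt0.
have n0 : (0 : R) <= n%:R by [].
have sn : s * n%:R * (2 * (K + 1)) = n%:R by rewrite mulrAC s1 mul1r.
apply: le_trans (H j n k j0 _ _ _); last 3 first.
- by rewrite jn nj.
- by rewrite -(ler_nat R); apply: le_trans k1 _; nra.
- by rewrite ler_pdivlMr //; nra.
apply: (Ex_le eps4 erwP) => v _; rewrite ler_nat.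
have : speed_below s n v -> left_of k.+1%:Z v.
  by rewrite /speed_below /left_of -(ltr_int R) => h; exact: le_lt_trans h k2.
by case: (speed_below s n v) => // ->.
Qed.

End Speed.

(** * The law of an excited random walk *)

Fixpoint trace (x : nat -> pos) (n : nat) : seq pos :=
  x n :: (if n is m.+1 then trace x m else [::]).

Lemma head_trace x n : head 0 (trace x n) = x n.
Proof. by case: n. Qed.

Lemma mem_trace x n z : reflect (exists2 k, (k <= n)%N & z = x k) (z \in trace x n).
Proof.
elim: n => [|n IH] /=.
  rewrite inE; apply: (iffP eqP) => [->|[k]]; first by exists 0%N.
  by rewrite leqn0 => /eqP->.
rewrite inE; apply: (iffP orP) => [[/eqP->|/IH[k kn ->]]|[k]].
- by exists n.+1.
- by exists k => //; exact: leqW.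
- rewrite leq_eqVlt => /orP[/eqP-> ->|kn zk]; [by left|right].
  by apply/IH; exists k.
Qed.

Lemma eq_trace x y n : (forall k, (k <= n)%N -> x k = y k) -> trace x n = trace y n.
Proof.
elim: n => [|n IH] H /=; first by rewrite H.
by rewrite H // IH // => k kn; apply: H; exact: leqW.
Qed.

Lemma fresh_trace x n : reflect (first_visit set0 x n) (fresh (trace x n)).
Proof.
rewrite /fresh head_trace; case: n => [|n] /=; first by constructor; split=> // -[].
apply: (iffP idP) => [/negP h|[_ h]].
  by split=> // k kn e; apply: h; apply/mem_trace; exists k.
by apply/negP => /mem_trace[k kn e]; exact: h kn e.
Qed.

Lemma erw_transition_trace (R : realType) (eps : R) (x : nat -> pos) n :
  let q y := erw_transition eps set0 x n (x n + y) in
  [/\ q (1, 0) = 4^-1 + erw eps (trace x n), q (-1, 0) = 4^-1 - erw eps (trace x n),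
      q (0, 1) = 4^-1 & q (0, -1) = 4^-1].
Proof.
rewrite /erw_transition /erw.
have -> : `[< first_visit set0 x n >] = fresh (trace x n).
  by apply/asboolP/idP => /fresh_trace.
case: fresh; rewrite ![x n + _ - _]addrAC !subrr !add0r //.
by rewrite addr0 subr0.
Qed.

Section Law.
Context (d : measure_display) (T : measurableType d) (R : realType).
Variables (P : probability T R) (eps : R) (E : nat -> T -> pos).
Hypothesis erwE : excited_random_walk P eps set0 (0, 0) E.

Definition pr (A : set T) : R := fine (P A).

Lemma prE A : measurable A -> P A = (pr A)%:E.
Proof. by move=> mA; rewrite /pr fineK //; exact: fin_num_measure. Qed.

Lemma pr_ge0 A : 0 <= pr A.
Proof. exact: fine_ge0. Qed.

Lemma pr_le A B : measurable A -> measurable B -> A `<=` B -> pr A <= pr B.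
Proof.
move=> mA mB AB; rewrite -lee_fin -!prE //.
by apply: le_measure => //; rewrite inE.
Qed.

Lemma pr_split X Y : measurable X -> measurable Y ->
  pr X = pr (X `&` Y) + pr (X `\` Y).
Proof.
move=> mX mY; apply: EFin_inj.
rewrite EFinD -!prE //; [|exact: measurableD|exact: measurableI].
by rewrite addeC; exact: measureDI.
Qed.

Lemma measurable_at n (B : set pos) : measurable (E n @^-1` B).
Proof. by case: erwE. Qed.

Lemma historyS x n : history E x n.+1 = history E x n `&` E n.+1 @^-1` [set x n.+1].
Proof.
apply/seteqP; split=> t /=.
  by move=> h; split; [move=> k kn; apply: h; exact: leqW|exact: h].
by move=> [h hn] k; rewrite leq_eqVlt => /orP[/eqP->//|]; exact: h.
Qed.

Lemma measurable_history x n : measurable (history E x n).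
Proof.
elim: n => [|n IH]; last by rewrite historyS; apply: measurableI => //; exact: measurable_at.
rewrite (_ : history E x 0 = E 0%N @^-1` [set x 0%N]); first exact: measurable_at.
apply/seteqP; split=> t /= h; first exact: h.
by move=> k; rewrite leqn0 => /eqP->.
Qed.

(** The values of [E n] outside [ys] contribute at most the leftover mass, so a finite sum
    suffices. *)
Lemma pr_exhaust (ys : seq pos) n (X A : set T) : uniq ys -> measurable X -> measurable A ->
  pr (X `&` A) <= \sum_(y <- ys) pr (X `&` E n @^-1` [set y] `&` A) +
    (pr X - \sum_(y <- ys) pr (X `&` E n @^-1` [set y])).
Proof.
elim: ys X => [|y ys IH] X /=.
  move=> _ mX mA; rewrite !big_nil add0r subr0; apply: pr_le => //; exact: measurableI.
move=> /andP[yys uys] mX mA.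
have mY z : measurable (E n @^-1` [set z]) by exact: measurable_at.
set Y := E n @^-1` [set y].
have := IH (X `\` Y) uys (measurableD mX (mY y)) mA.
have eY z : z \in ys -> (X `\` Y) `&` E n @^-1` [set z] = X `&` E n @^-1` [set z].
  move=> zys; apply/seteqP; split=> t /=; first by move=> [[]].
  by move=> [Xt ez]; split=> //; split=> // ey; move: yys; rewrite -ey ez zys.
have -> : \sum_(z <- ys) pr ((X `\` Y) `&` E n @^-1` [set z] `&` A) =
    \sum_(z <- ys) pr (X `&` E n @^-1` [set z] `&` A).
  by rewrite big_seq [RHS]big_seq; apply: eq_bigr => z zys; rewrite eY.
have -> : \sum_(z <- ys) pr ((X `\` Y) `&` E n @^-1` [set z]) =
    \sum_(z <- ys) pr (X `&` E n @^-1` [set z]).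
  by rewrite big_seq [RHS]big_seq; apply: eq_bigr => z zys; rewrite eY.
rewrite !big_cons.
rewrite (pr_split mX (mY y)) (pr_split (measurableI _ _ mX mA) (mY y)) -/Y.
rewrite setIAC (_ : (X `&` A) `\` Y = (X `\` Y) `&` A); last first.
  by apply/seteqP; split=> t /= [[]].
lra.
Qed.

Lemma pr_step x n y : pr (history E x n `&` E n.+1 @^-1` [set y]) =
  pr (history E x n) * erw_transition eps set0 x n y.
Proof.
have mH := measurable_history x n.
(* On a null history the transition rule says nothing, but both sides vanish. *)
have [H0|Hpos] := leP (P (history E x n)) 0%E.
  have h0 : pr (history E x n) <= 0 by rewrite -lee_fin -prE.
  have h1 : pr (history E x n) = 0 by apply/eqP; rewrite eq_le h0 pr_ge0.
  rewrite h1 mul0r; apply/eqP; rewrite eq_le pr_ge0 andbT -h1.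
  by apply: pr_le => //; apply: measurableI => //; exact: measurable_at.
case: erwE => _ _ /(_ n x y Hpos) <-; rewrite /cond_prob -/(pr _) -/(pr _).
rewrite setIC mulrC divfK // gt_eqF //.
by rewrite -lte_fin -prE.
Qed.

Definition extend (x : nat -> pos) n (e : pos) : nat -> pos :=
  fun i => if (i <= n)%N then x i else x n + e.

Lemma history_extend x n e :
  history E (extend x n e) n.+1 = history E x n `&` E n.+1 @^-1` [set x n + e].
Proof.
rewrite historyS /extend ltnn; congr (_ `&` _).
by apply/seteqP; split=> t h k kn; have := h k kn; rewrite kn.
Qed.

Lemma trace_extend x n e : trace (extend x n e) n.+1 = move (trace x n) e.
Proof.
rewrite /= /move head_trace {1}/extend ltnn; congr (_ :: _).
by apply: eq_trace => k kn; rewrite /extend kn.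
Qed.

(** Split over the four neighbours: their transition probabilities add up to 1, so the leftover mass
    in [pr_exhaust] is 0. *)
Lemma pr_history_le (c : pred pos) n k x :
  pr (history E x k `&` E (k + n) @^-1` [set y | c y]) <=
  pr (history E x k) * Ex (erw eps) n (trace x k) (fun v => (c (head 0 v))%:R).
Proof.
elim: n k x => [|n IH] k x.
  rewrite addn0 /= head_trace; case: (boolP (c (x k))) => cx.
    rewrite mulr1; apply: pr_le => //; [|exact: measurable_history].
    by apply: measurableI; [exact: measurable_history|exact: measurable_at].
  rewrite mulr0 (_ : _ `&` _ = set0) ?/pr ?measure0 //.
  by apply/seteqP; split=> t //= [/(_ k (leqnn k)) ->]; rewrite (negbTE cx).
set A := E _ @^-1` _.
have mA : measurable A by exact: measurable_at.
have := @pr_exhaust [seq x k + e | e <- dirs] k.+1 (history E x k) A _ (measurable_history x k) mA.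
rewrite map_inj_uniq; last exact: addrI.
move=> /(_ isT) h; apply: le_trans h _.
have step e : pr (history E x k `&` E k.+1 @^-1` [set x k + e] `&` A) <=
   pr (history E x k) * erw_transition eps set0 x k (x k + e) *
     Ex (erw eps) n (move (trace x k) e) (fun v => (c (head 0 v))%:R).
  by have := IH k.+1 (extend x k e); rewrite trace_extend history_extend pr_step addSnnS.
rewrite !big_map /dirs !big_cons !big_nil !pr_step.
have [q1 q2 q3 q4] := erw_transition_trace eps x k.
have := step (1, 0); have := step (-1, 0); have := step (0, 1); have := step (0, -1).
rewrite q1 q2 q3 q4 /= /avg.
set p := pr _; set a := erw _ _.
set e1 := Ex _ _ _ _; set e2 := Ex _ _ _ _; set e3 := Ex _ _ _ _; set e4 := Ex _ _ _ _.
lra.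
Qed.

Lemma pr_law_le (c : pred pos) n :
  pr (E n @^-1` [set y | c y]) <= Ex (erw eps) n [:: 0] (fun v => (c (head 0 v))%:R).
Proof.
pose x : nat -> pos := fun=> 0.
have H1 : pr (history E x 0) = 1.
  case: erwE => _ h _; rewrite /pr -[RHS]/(fine 1%E) -h; congr (fine (P _)).
  apply/seteqP; split=> t /= h0; first exact: h0.
  by move=> k; rewrite leqn0 => /eqP->.
have mA := measurable_at n [set y | c y].
have mH := measurable_history x 0.
have := pr_history_le c n 0 x; rewrite H1 mul1r add0n; apply: le_trans.
rewrite (pr_split mA mH) setIC gerDl.
have := pr_split measurableT mH; rewrite setTI setTD H1.
have -> : pr setT = 1 by rewrite /pr probability_setT.
move=> h; have -> : 0 = pr (~` history E x 0) by lra.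
apply: pr_le; [exact: measurableD|exact: measurableC|by move=> t []].
Qed.

End Law.

Lemma ln_sq_le (R : realType) (y : R) : 1 <= y -> ln y ^+ 2 <= 4 * y.
Proof.
move=> y1; have l0 : 0 <= ln y := ln_ge0 y1.
have h := expR_ge1Dx (ln y / 2).
have e : expR (ln y / 2) ^+ 2 = y.
  by rewrite -expRM_natr divfK ?lnK // posrE; lra.
rewrite -[in leRHS]e; move: h; set x := expR _; nra.
Qed.

(** Here log n <= A log (j + 1), whose square is linear in j + 1 by [ln_sq_le]; the summand 1 covers
    the case where [log1] is 1 by convention. *)
Lemma log1_sq_le (R : realType) (A j n : nat) : (0 < n)%N -> (n < j.+1 ^ A)%N ->
  log1 (n%:R : R) ^+ 2 <= (4 * A%:R ^+ 2 + 1) * j.+1%:R.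
Proof.
move=> n0 nj.
have n1 : (1 : R) <= n%:R by rewrite ler1n.
have j1 : (1 : R) <= j.+1%:R by rewrite ler1n.
have l0 : 0 <= ln (n%:R : R) := ln_ge0 n1.
have lj : 0 <= ln (j.+1%:R : R) := ln_ge0 j1.
have lnle : ln (n%:R : R) <= A%:R * ln j.+1%:R.
  rewrite mulr_natl -lnXn // ler_ln ?posrE ?exprn_gt0 ?ltr0n // -natrX ler_nat; exact: ltnW.
have h1 : ln (n%:R : R) ^+ 2 <= A%:R ^+ 2 * (4 * j.+1%:R).
  apply: (@le_trans _ _ ((A%:R * ln j.+1%:R) ^+ 2)).
    by rewrite lerXn2r ?nnegrE // mulr_ge0.
  by rewrite exprMn ler_wpM2l ?exprn_ge0 // ln_sq_le.
have A0 : 0 <= (A%:R : R) ^+ 2 by rewrite exprn_ge0.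
have A1 : 0 <= A%:R ^+ 2 * (4 * j.+1%:R) :> R by rewrite mulr_ge0 // mulr_ge0.
rewrite mulrDl mul1r.
have -> : 4 * A%:R ^+ 2 * j.+1%:R = A%:R ^+ 2 * (4 * j.+1%:R) :> R by ring.
rewrite /log1 /Num.max; case: ifP => _; first by rewrite expr1n; lra.
lra.
Qed.

Theorem mainTheorem1 (R : realType) (eps : R) (heps0 : 0 < eps)
    (heps4 : eps < 4^-1) :
  exists C c : R, [/\ 0 < C, 0 < c &
    forall (d : measure_display) (T : measurableType d) (P : probability T R)
      (E : nat -> T -> int * int),
      excited_random_walk P eps set0 (0, 0) E ->
      forall n : nat, (1 <= n)%N ->
      ((1 - C * expR (- c * log1 (n%:R : R) ^+ 2))%:E
        < P [set t | (c * n%:R < ((E n t).1)%:~R :> R)%R])%E].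
Proof.
have [s [C [c [s0 C0 c0 H]]]] := speed heps0 heps4.
pose L : R := 4 * 45%:R ^+ 2 + 1.
have L0 : 0 < L by rewrite addr_gt0 // mulr_gt0 // exprn_gt0.
pose c' := Num.min s (c / L).
have c'0 : 0 < c' by rewrite lt_min s0 divr_gt0.
(* The factor [expR c] pays for passing from [j] to [j.+1], and the added 1 makes the inequality
   strict. *)
exists (C * expR c + 1), c'; split => //.
  by rewrite addr_gt0 // mulr_gt0 // expR_gt0.
move=> d T P E hE n n1.
have [j /andP[jn nj]] := root_floor n (isT : (0 < 45)%N).
have hlog := @log1_sq_le R 45 j n n1 nj.
set e := expR (- c' * _); have e0 : 0 < e by exact: expR_gt0.
have ej : expR (- c * j%:R) <= expR c * e.
  rewrite /e -expRD ler_expR.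
  have h1 : c' * log1 (n%:R : R) ^+ 2 <= c / L * (L * j.+1%:R).
    by apply: ler_pM => //; [exact: ltW|exact: sqr_ge0|rewrite ge_min lexx orbT].
  have h2 : c / L * (L * j.+1%:R) = c * j%:R + c.
    by rewrite -natr1; field; rewrite gt_eqF.
  by rewrite h2 in h1; rewrite !mulNr; lra.
have Hs : pr P (E n @^-1` [set y | y.1%:~R <= s * n%:R]) <= C * expR (- c * j%:R).
  exact: le_trans (pr_law_le hE (fun y => y.1%:~R <= s * n%:R) n) (H j n jn).
set A := E n @^-1` _ in Hs.
have mA : measurable A by exact: (measurable_at hE).
set B := [set t | _].
have mB : measurable B.
  exact: (measurable_at hE n [set y | c' * n%:R < y.1%:~R]).
have AB : ~` A `<=` B.
  move=> t /negP; rewrite /B /= -ltNge; apply: le_lt_trans.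
  by rewrite ler_wpM2r // ge_min lexx.
rewrite prE // lte_fin.
have h := pr_le P (measurableC mA) mB AB.
have hA := pr_split P measurableT mA; rewrite setTI setTD in hA.
have hT : pr P setT = 1 by rewrite /pr probability_setT.
have : C * expR (- c * j%:R) <= C * expR c * e.
  by rewrite -mulrA ler_wpM2l // ltW.
rewrite mulrDl mul1r; lra.
Qed.
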